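(* Let $\varphi$ and $\psi$ be degree-four rational maps on $\mathbb{P}^1$ over $k$ whose cubic components $G$ have three distinct roots. Then $\varphi$ and $\psi$ are conjugate if and only if the fourteen functions $$U_1,\ U_2,\ 3U_3,\ U_4,\ U_5,\ U_6,\qquad \frac{Q_g}{D^{m_g}}\quad(g=e_2,p_{02},p_{12},p_{03},w_2,w_{21},w_{12},w_{03})$$ defined in the context take the same values at $\varphi$ and $\psi$.
   Context: $k$ is an algebraically closed field of characteristic zero, and $V_n$ is the space of binary forms of order (degree) $n$ in $x,y$ over $k$. A degree-four rational map is $\varphi=[f_0:f_1]$ with $f_0,f_1\in V_4$, $\mathrm{Res}(f_0,f_1)\neq0$, up to a common nonzero scalar; conjugate means conjugate under $\mathrm{PGL}_2(k)$. Its Clebsch–Gordan pair is $(F,G)=(yf_0-xf_1,(f_0)_x+(f_1)_y)\in V_5\oplus V_3$ (up to a common scalar), $G$ is its cubic component, and functions of $\varphi$ are evaluated at this pair. Transvectants: for binary forms $A,B$ of orders $m,n$, $$(A,B)_r=\frac{(m-r)!(n-r)!}{m!\,n!}\sum_{j=0}^r(-1)^j\binom rj\frac{\partial^rA}{\partial x^{r-j}\partial y^j}\frac{\partial^rB}{\partial x^j\partial y^{r-j}}.$$ Covariants: $H=(F,F)_2$, $i=(F,F)_4$, $t=(F,H)_1$, $c_{3,5}=(i,F)_1$, $c_{3,3}=(i,F)_2$; $h=(G,G)_2$, $q=(G,h)_1$, $D=(h,h)_2$. Joint invariants: $A=(F,Gh)_5$, $L=(F,hq)_5$, $B_1=(i,h)_2$,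 $B_2=(H,G^2)_6$, $M=(H,Gq)_6$, $N=(H,q^2)_6$, $R=(c_{3,3},G)_3$, $S_1=(c_{3,3},q)_3$, $S_2=(c_{3,5},Gh)_5$, $S_3=(t,G^3)_9$, $T_1=(c_{3,5},hq)_5$, $T_2=(t,G^2q)_9$, $T_3=(F^3,G^5)_{15}$, $W=(F^3,G^4q)_{15}$. $U_i=P_i/(c_iD^{m_i})$ with $(c_1,\dots,c_6)=(3,54,20432412,18,2270268,27027)$, $(m_1,\dots,m_6)=(1,3,4,3,4,6)$ and $P_1=700A$; $P_2=5^3\bigl(98010L^2+190080DN+47045DA^2+97000D^2B_2-19224D^2B_1\bigr)$; $P_3=5^5\bigl(63868314510AL^2+49446437040DLM+148589040600DAN+31976059115DA^3+560560D^2T_3-164989440D^2T_2-45305310960D^2T_1+98893534740D^2AB_2-39968032104D^2AB_1+7720750752D^3R\bigr)$; $P_4=-5\bigl(632610L^2+803520DN+165385DA^2+552680D^2B_2-98424D^2B_1\bigr)$; $P_5=-5^3\bigl(216453026790AL^2+514942187760DLM+493336803960DAN+112492234855DA^3+83523440D^2T_3-16672803840D^2T_2-290479054320D^2T_1+491566054980D^2AB_2-218716874376D^2AB_1-12670582496D^3R\bigr)$; $P_6=-5^6\bigl(67988850930L^4+197785748160DL^2N+33952803885DA^2L^2-560560D^2LW+79622318160D^2L^2B_2-39182280984D^2L^2B_1+19394519760D^2ALM-82457760D^3LS_3+21320456220D^3LS_2+9857393568D^3LS_1\bigr)$. The $Q_g$ (subscripts $g$ are labels), with exponents $m_g=3,3,4,4,4,6,6,6$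 for $g=e_2,p_{02},p_{12},p_{03},w_2,w_{21},w_{12},w_{03}$: $Q_{e_2}=264600L^2$; $Q_{p_{02}}=\frac1{30}\bigl(4083210L^2+D(2453760N+581405A^2+D(2687080B_2-835416B_1))\bigr)$; $Q_{p_{12}}=\frac{5}{756756}\bigl(133383920670AL^2+D(4587439736880LM+1869573265560AN+407613761555A^3+D(12444992560T_3-1305564986880T_2-1725889117680T_1+2239075899060AB_2-1153318029864AB_1-289845437024DR))\bigr)$; $Q_{p_{03}}=\frac1{252252}\bigl(1459163675970AL^2-D(7553317852080LM+2899790613720AN+648701088035A^3+D(370860778288T_3-3781089607680T_2-1987532754480T_1+2085082539540AB_2-1274048816040AB_1-459131079264DR))\bigr)$; $Q_{w_2}=49392000L(DM-AL)$; $Q_{w_{21}}=\frac{625}{9009}L\bigl(438837128730L^3+982935233280DLN+215194604625DA^2L-83523440D^2W+526319806320D^2LB_2-178109310456D^2LB_1-22314544560D^2AM-8330894880D^3S_3+75289456620D^3S_2+99761875488D^3S_1\bigr)$; $Q_{w_{12}}=\frac{25}{3003}L\bigl(-2832494194530L^3-4448817172800DLN-1081547792325DA^2L+12444992560D^2W-3200034111120D^2LB_2+914989205592D^2LB_1-8471509200D^2AM+651961944480D^3S_3-291086990460D^3S_2-664047594144D^3S_1\bigr)$; $Q_{w_{03}}=\frac1{1001}L\bigl(18282462528330L^3+16479966222720DLN+3176968579785DA^2L-1854303891440D^2W+18276219284400D^2LB_2-5198207741496D^2LB_1+4876420626000D^2AM-9330462224160D^3S_3+1385837078220D^3S_2+3660996971808D^3S_1\bigr)$.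 *)

(* Defs.v *)
From mathcomp Require Import all_boot all_order all_algebra.
From mathcomp Require Import mpoly.

Set Implicit Arguments.
Unset Strict Implicit.
Unset Printing Implicit Defensive.

Set Warnings "-abstract-large-number".

Import GRing.Theory.
Local Open Scope ring_scope.

(* A binary form of order n over k in the variables x = 'X_0 and y = 'X_1 is  *)
(* a polynomial F : {mpoly k[2]} with F \is n.-homog. The zero form has every *)
(* order, so operations that depend on the order take it as an argument.      *)

Section BinaryForms.
Variable k : fieldType.
Implicit Types F A B : {mpoly k[2]}.

(* the coefficient of x^(n-i) y^i *)
Definition bcoef (n : nat) F (i : nat) : k :=
  F@_(U_(0%R : 'I_2) *+ (n - i) + U_(1%R : 'I_2) *+ i)%MM.

(* Rows of the Sylvester matrix: the coefficients of an order n form, shifted *)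
(* to the right by the row index.                                             *)
Definition sylvester_rows (n m l : nat) F : 'M[k]_(m, l) :=
  \matrix_(i < m, j < l) (if (i <= j <= i + n)%N then bcoef n F (j - i) else 0).

(* Unlike the univariate resultant, this depends on the orders m and n rather *)
(* than on degrees, and detects common zeros at infinity.                     *)
Definition bresultant (m n : nat) A B : k :=
  \det (col_mx (sylvester_rows m n (n + m) A) (sylvester_rows n m (n + m) B)).

(* d^(i+j) F / dx^i dy^j *)
Definition dxy (i j : nat) F : {mpoly k[2]} :=
  F^`M[(U_(0%R : 'I_2) *+ i + U_(1%R : 'I_2) *+ j)%MM].

Definition transvectant (m n r : nat) A B : {mpoly k[2]} :=
  ((m - r)`!%:R * (n - r)`!%:R / (m`!%:R * n`!%:R)) *:
    \sum_(j < r.+1)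
      ((-1) ^+ j * 'C(r, j)%:R) *: (dxy (r - j) j A * dxy j (r - j) B).

(* A full transvectant has order 0, i.e. it is a constant form; this is its   *)
(* value in k.                                                                *)
Definition full_transvectant (r : nat) A B : k := (transvectant r r r A B)@_0%MM.

(* F is nonzero and has (at least) n distinct roots in P^1, the points of P^1 *)
(* being given by homogeneous coordinates. When F has order n this means that *)
(* all its roots are simple.                                                  *)
Definition has_distinct_roots (n : nat) F : Prop :=
  F != 0 /\
  exists p : 'I_n -> 'rV[k]_2,
    (forall i, p i != 0 /\ F.@[p i 0] = 0) /\
    (forall i j, i != j -> forall c : k, p i != c *: p j).

End BinaryForms.

Section RationalMaps.
Variable k : fieldType.

(* A degree d rational map [f_0 : f_1] on P^1, given by a representative; two *)
(* representatives define the same map when they satisfy proportional.        *)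
Record ratmap (d : nat) := RatMap {
  ratmap_comp :> 'I_2 -> {mpoly k[2]};
  ratmap_homog : forall i, ratmap_comp i \is d.-homog;
  ratmap_res : bresultant d d (ratmap_comp 0) (ratmap_comp 1) != 0
}.

Definition proportional (f f' : 'I_2 -> {mpoly k[2]}) : Prop :=
  exists2 c : k, c != 0 & forall i, f' i = c *: f i.

(* f o g and g o f, for g the linear map sending the column (x, y)^T to       *)
(* g *m (x, y)^T.                                                             *)
Definition precomp (g : 'M[k]_2) (f : 'I_2 -> {mpoly k[2]}) i : {mpoly k[2]} :=
  f i \mPo [tuple \sum_(j < 2) g l j *: 'X_j | l < 2].
Definition postcomp (g : 'M[k]_2) (f : 'I_2 -> {mpoly k[2]}) i : {mpoly k[2]} :=
  \sum_(j < 2) g i j *: f j.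

(* psi = g^-1 o phi o g for the class in PGL_2(k) of an invertible matrix g   *)
Definition conjugate d (phi psi : ratmap d) : Prop :=
  exists2 g : 'M[k]_2, g \in unitmx &
    proportional (postcomp (invmx g) (precomp g phi)) psi.

Definition CG_quintic (f : 'I_2 -> {mpoly k[2]}) : {mpoly k[2]} :=
  'X_1 * f 0 - 'X_0 * f 1.
Definition CG_cubic (f : 'I_2 -> {mpoly k[2]}) : {mpoly k[2]} :=
  (f 0)^`M(0) + (f 1)^`M(1).

End RationalMaps.

Section Invariants.
Variable k : fieldType.
(* F of order 5 and G of order 3 *)
Variables F G : {mpoly k[2]}.

Definition cov_H := transvectant 5 5 2 F F.          (* order 6 *)
Definition cov_i := transvectant 5 5 4 F F.          (* order 2 *)
Definition cov_t := transvectant 5 6 1 F cov_H.      (* order 9 *)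
Definition cov_c35 := transvectant 2 5 1 cov_i F.    (* order 5 *)
Definition cov_c33 := transvectant 2 5 2 cov_i F.    (* order 3 *)
Definition cov_h := transvectant 3 3 2 G G.          (* order 2 *)
Definition cov_q := transvectant 3 2 1 G cov_h.      (* order 3 *)

Definition inv_D := full_transvectant 2 cov_h cov_h.
Definition inv_A := full_transvectant 5 F (G * cov_h).
Definition inv_L := full_transvectant 5 F (cov_h * cov_q).
Definition inv_B1 := full_transvectant 2 cov_i cov_h.
Definition inv_B2 := full_transvectant 6 cov_H (G ^+ 2).
Definition inv_M := full_transvectant 6 cov_H (G * cov_q).
Definition inv_N := full_transvectant 6 cov_H (cov_q ^+ 2).
Definition inv_R := full_transvectant 3 cov_c33 G.
Definition inv_S1 := full_transvectant 3 cov_c33 cov_q.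
Definition inv_S2 := full_transvectant 5 cov_c35 (G * cov_h).
Definition inv_S3 := full_transvectant 9 cov_t (G ^+ 3).
Definition inv_T1 := full_transvectant 5 cov_c35 (cov_h * cov_q).
Definition inv_T2 := full_transvectant 9 cov_t (G ^+ 2 * cov_q).
Definition inv_T3 := full_transvectant 15 (F ^+ 3) (G ^+ 5).
Definition inv_W := full_transvectant 15 (F ^+ 3) (G ^+ 4 * cov_q).

Local Notation D := inv_D.
Local Notation A := inv_A.
Local Notation L := inv_L.
Local Notation B1 := inv_B1.
Local Notation B2 := inv_B2.
Local Notation M := inv_M.
Local Notation N := inv_N.
Local Notation R := inv_R.
Local Notation S1 := inv_S1.
Local Notation S2 := inv_S2.
Local Notation S3 := inv_S3.
Local Notation T1 := inv_T1.
Local Notation T2 := inv_T2.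
Local Notation T3 := inv_T3.
Local Notation W := inv_W.

(* Integer constants are written n%:R, with n parsed in nat_scope, because a  *)
(* bare ring_scope numeral is expanded to a unary natural number.             *)

Definition P1 : k :=
  700%:R * A.

Definition P2 : k :=
  5%:R ^+ 3 * (98010%:R * L ^+ 2 + 190080%:R * D * N + 47045%:R * D * A ^+ 2
    + 97000%:R * D ^+ 2 * B2 - 19224%:R * D ^+ 2 * B1).

Definition P3 : k :=
  5%:R ^+ 5 * (63868314510%:R * A * L ^+ 2 + 49446437040%:R * D * L * M
    + 148589040600%:R * D * A * N + 31976059115%:R * D * A ^+ 3
    + 560560%:R * D ^+ 2 * T3 - 164989440%:R * D ^+ 2 * T2
    - 45305310960%:R * D ^+ 2 * T1 + 98893534740%:R * D ^+ 2 * A * B2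
    - 39968032104%:R * D ^+ 2 * A * B1 + 7720750752%:R * D ^+ 3 * R).

Definition P4 : k :=
  - (5%:R * (632610%:R * L ^+ 2 + 803520%:R * D * N + 165385%:R * D * A ^+ 2
    + 552680%:R * D ^+ 2 * B2 - 98424%:R * D ^+ 2 * B1)).

Definition P5 : k :=
  - (5%:R ^+ 3 * (216453026790%:R * A * L ^+ 2 + 514942187760%:R * D * L * M
    + 493336803960%:R * D * A * N + 112492234855%:R * D * A ^+ 3
    + 83523440%:R * D ^+ 2 * T3 - 16672803840%:R * D ^+ 2 * T2
    - 290479054320%:R * D ^+ 2 * T1 + 491566054980%:R * D ^+ 2 * A * B2
    - 218716874376%:R * D ^+ 2 * A * B1 - 12670582496%:R * D ^+ 3 * R)).

Definition P6 : k :=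
  - (5%:R ^+ 6 * (67988850930%:R * L ^+ 4 + 197785748160%:R * D * L ^+ 2 * N
    + 33952803885%:R * D * A ^+ 2 * L ^+ 2 - 560560%:R * D ^+ 2 * L * W
    + 79622318160%:R * D ^+ 2 * L ^+ 2 * B2
    - 39182280984%:R * D ^+ 2 * L ^+ 2 * B1
    + 19394519760%:R * D ^+ 2 * A * L * M - 82457760%:R * D ^+ 3 * L * S3
    + 21320456220%:R * D ^+ 3 * L * S2 + 9857393568%:R * D ^+ 3 * L * S1)).

Definition Q_e2 : k :=
  264600%:R * L ^+ 2.

Definition Q_p02 : k :=
  (4083210%:R * L ^+ 2 + D * (2453760%:R * N + 581405%:R * A ^+ 2
    + D * (2687080%:R * B2 - 835416%:R * B1))) / 30%:R.

Definition Q_p12 : k :=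
  5%:R * (133383920670%:R * A * L ^+ 2 + D * (4587439736880%:R * L * M
    + 1869573265560%:R * A * N + 407613761555%:R * A ^+ 3
    + D * (12444992560%:R * T3 - 1305564986880%:R * T2 - 1725889117680%:R * T1
    + 2239075899060%:R * A * B2 - 1153318029864%:R * A * B1
    - 289845437024%:R * D * R))) / 756756%:R.

Definition Q_p03 : k :=
  (1459163675970%:R * A * L ^+ 2 - D * (7553317852080%:R * L * M
    + 2899790613720%:R * A * N + 648701088035%:R * A ^+ 3
    + D * (370860778288%:R * T3 - 3781089607680%:R * T2
    - 1987532754480%:R * T1 + 2085082539540%:R * A * B2
    - 1274048816040%:R * A * B1 - 459131079264%:R * D * R))) / 252252%:R.

Definition Q_w2 : k :=
  49392000%:R * L * (D * M - A * L).

Definition Q_w21 : k :=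
  625%:R * L * (438837128730%:R * L ^+ 3 + 982935233280%:R * D * L * N
    + 215194604625%:R * D * A ^+ 2 * L - 83523440%:R * D ^+ 2 * W
    + 526319806320%:R * D ^+ 2 * L * B2 - 178109310456%:R * D ^+ 2 * L * B1
    - 22314544560%:R * D ^+ 2 * A * M - 8330894880%:R * D ^+ 3 * S3
    + 75289456620%:R * D ^+ 3 * S2 + 99761875488%:R * D ^+ 3 * S1) / 9009%:R.

Definition Q_w12 : k :=
  25%:R * L * (- 2832494194530%:R * L ^+ 3 - 4448817172800%:R * D * L * N
    - 1081547792325%:R * D * A ^+ 2 * L + 12444992560%:R * D ^+ 2 * W
    - 3200034111120%:R * D ^+ 2 * L * B2 + 914989205592%:R * D ^+ 2 * L * B1
    - 8471509200%:R * D ^+ 2 * A * M + 651961944480%:R * D ^+ 3 * S3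
    - 291086990460%:R * D ^+ 3 * S2
    - 664047594144%:R * D ^+ 3 * S1) / 3003%:R.

Definition Q_w03 : k :=
  L * (18282462528330%:R * L ^+ 3 + 16479966222720%:R * D * L * N
    + 3176968579785%:R * D * A ^+ 2 * L - 1854303891440%:R * D ^+ 2 * W
    + 18276219284400%:R * D ^+ 2 * L * B2 - 5198207741496%:R * D ^+ 2 * L * B1
    + 4876420626000%:R * D ^+ 2 * A * M - 9330462224160%:R * D ^+ 3 * S3
    + 1385837078220%:R * D ^+ 3 * S2
    + 3660996971808%:R * D ^+ 3 * S1) / 1001%:R.

Definition U1 : k := P1 / (3%:R * D).
Definition U2 : k := P2 / (54%:R * D ^+ 3).
Definition U3 : k := P3 / (20432412%:R * D ^+ 4).
Definition U4 : k := P4 / (18%:R * D ^+ 3).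
Definition U5 : k := P5 / (2270268%:R * D ^+ 4).
Definition U6 : k := P6 / (27027%:R * D ^+ 6).

Definition fourteen_functions : seq k :=
  [:: U1; U2; 3%:R * U3; U4; U5; U6;
      Q_e2 / D ^+ 3; Q_p02 / D ^+ 3; Q_p12 / D ^+ 4; Q_p03 / D ^+ 4;
      Q_w2 / D ^+ 4; Q_w21 / D ^+ 6; Q_w12 / D ^+ 6; Q_w03 / D ^+ 6].

End Invariants.

Definition fourteen_values (k : fieldType) (phi : ratmap k 4) : seq k :=
  fourteen_functions (CG_quintic phi) (CG_cubic phi).

(* Main.v *)
Require Import Defs.
From mathcomp Require Import all_boot all_order all_algebra.
From mathcomp Require Import mpoly ring.

(* A conjugation by g in GL_2 multiplies a transvectant of order r by det g ^ r,
   so that it multiplies each of the invariants by a power of a common factor mu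
   whose exponent is half the degree; the fourteen functions are quotients of
   the same degree, hence invariant.

   Conversely, the Clebsch-Gordan pair (F, G) determines the map, and since G
   has three distinct roots, a conjugation makes it equal to x^3 + y^3. What
   remains is the group S_3 permuting the roots of G, acting on quintic forms F,
   i.e., on trivial + sign + 2 (standard). In suitable coordinates s, e, (u1, u2),
   (v1, v2), the numerators of the fourteen functions are, up to an invertible
   linear change, s, e^2, u1 u2, u1 v2 + u2 v1, v1 v2, the four polarizations of
   u1^3 + u2^3, and e times u1 v2 - u2 v1 and the four polarizations of
   u1^3 - u2^3. These separate the orbits of S_3. *)

Set Implicit Arguments.
Unset Strict Implicit.
Unset Printing Implicit Defensive.

Set Warnings "-abstract-large-number".

Import GRing.Theory.
Local Open Scope ring_scope.

(** * Linear substitutions *)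

(** A scalar matrix acts on a Clebsch-Gordan pair as a mere change of [a], so up to scalings the
    acting group is PGL_2. The scaling is spent on making the cubic exactly x^3 + y^3; each
    permutation of its roots then comes with a determined scalar, which leaves S_3 itself. The
    delicate point of the separation is the sign of e. The S_3-invariants of (u, v) determine (u, v)
    up to S_3, and e^2 determines e up to sign, but the two choices may disagree; the products of e
    with functions that reflections negate decide. If e is nonzero and has the wrong sign, these
    functions vanish, so (u, v) is fixed by some reflection, and composing with it corrects the sign
    of e without moving (u, v). The large constants come from another basis of the two standard
    copies, p = u + 98 v and r = 149 u + 490 v, of determinant -14112 = -2^5 3^2 7^2: apart from
    [P1] and [Q_e2], each numerator is a constant times one polarization in p and r, or e times
    one. *)

Fact lift01 : lift (0 : 'I_2) 0 = 1.
Proof. exact/val_inj. Qed.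

Lemma det2E (R : comNzRingType) (g : 'M[R]_2) :
  \det g = g 0 0 * g 1 1 - g 0 1 * g 1 0.
Proof.
rewrite (expand_det_row _ 0) !big_ord_recl big_ord0 addr0 /cofactor !det_mx11.
have lift10 : lift (1 : 'I_2) 0 = 0 by apply/val_inj.
by rewrite !mxE /= expr0 expr1 lift01 lift10 mul1r mulN1r mulrN.
Qed.

Fact addr_lin (R : pzRingType) (V : lmodType R) (x y : R) (a b c d : V) :
  x *: a + y *: b + (x *: c + y *: d) = x *: (a + c) + y *: (b + d).
Proof. by rewrite !scalerDr addrACA. Qed.

Fact leibniz_lin (R : nzRingType) (V : algType R) (x y : R)
    (p q p0 p1 q0 q1 : V) :
  (x *: p0 + y *: p1) * q + p * (x *: q0 + y *: q1) =
  x *: (p0 * q + p * q0) + y *: (p1 * q + p * q1).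
Proof. by rewrite mulrDl mulrDr -!scalerAl -!scalerAr addr_lin. Qed.

Section Substitution.
Variable k : fieldType.
Implicit Types (p A B : {mpoly k[2]}) (g h : 'M[k]_2).

Definition lsub g p : {mpoly k[2]} :=
  p \mPo [tuple \sum_(j < 2) g l j *: 'X_j | l < 2].

(** Suited to comparing ring morphisms, or derivations along them: such identities pass through sums
    and products, which leaves constants and the two variables. *)
Lemma mpoly_ring_ind (P : {mpoly k[2]} -> Prop) :
    (forall c, P c%:MP) -> (forall i, P 'X_i) ->
    (forall p q, P p -> P q -> P (p + q)) ->
    (forall p q, P p -> P q -> P (p * q)) ->
  forall p, P p.
Proof.
move=> PC PX PD PM; elim/mpolyind => [|c m p _ _ Pp]; first exact: (PC 0).
apply: (PD) => //; rewrite -mul_mpolyC; apply: (PM) => //.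
rewrite mpolyXE_id; apply: (big_ind P (PC 1) PM) => i _.
by elim: (m i) => [|n IHn]; [exact: (PC 1) | rewrite exprS; apply: PM].
Qed.

Lemma lsubC g c : lsub g c%:MP = c%:MP.
Proof. exact: comp_mpolyC. Qed.

Lemma lsubX g i : lsub g 'X_i = g i 0 *: 'X_0 + g i 1 *: 'X_1.
Proof.
rewrite /lsub comp_mpolyXU -tnth_nth tnth_mktuple !big_ord_recl big_ord0 addr0.
by rewrite lift01.
Qed.

Lemma lsubD g : {morph lsub g : p q / p + q}.
Proof. exact: comp_mpolyD. Qed.

Lemma lsubB g : {morph lsub g : p q / p - q}.
Proof. exact: comp_mpolyB. Qed.

Lemma lsubM g : {morph lsub g : p q / p * q}.
Proof. exact: rmorphM. Qed.

Lemma lsubXn g n : {morph lsub g : p / p ^+ n}.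
Proof. exact: rmorphXn. Qed.

Lemma lsubZ g c p : lsub g (c *: p) = c *: lsub g p.
Proof. exact: comp_mpolyZ. Qed.

Lemma lsub1 p : lsub 1%:M p = p.
Proof.
elim/mpoly_ring_ind: p => [c|i|p q IHp IHq|p q IHp IHq].
- by rewrite lsubC.
- rewrite lsubX !mxE; case: i => [[|[|i]] lti] //=;
    rewrite scale1r scale0r ?addr0 ?add0r; congr mpolyX;
    congr mnm1; exact/val_inj.
- by rewrite lsubD IHp IHq.
- by rewrite lsubM IHp IHq.
Qed.

Lemma lsub_mulmx g h p : lsub (g *m h) p = lsub h (lsub g p).
Proof.
elim/mpoly_ring_ind: p => [c|i|p q IHp IHq|p q IHp IHq].
- by rewrite !lsubC.
- rewrite !lsubX lsubD !lsubZ !lsubX !mxE !big_ord_recl !big_ord0 !addr0.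
  rewrite lift01 !scalerDl !scalerDr !scalerA -!addrA; congr (_ + _).
  by rewrite addrCA.
- by rewrite !lsubD IHp IHq.
- by rewrite !lsubM IHp IHq.
Qed.

Lemma mcoeff0_lsub g p : (lsub g p)@_0 = p@_0.
Proof.
elim/mpoly_ring_ind: p => [c|i|p q IHp IHq|p q IHp IHq].
- by rewrite lsubC.
- by rewrite lsubX mcoeffD !mcoeffZ !mcoeffX !mnm1_eq0 !mulr0 addr0.
- by rewrite lsubD !mcoeffD IHp IHq.
- by rewrite lsubM !rmorphM /= IHp IHq.
Qed.

Lemma mderivXU (i j : 'I_2) : ('X_i : {mpoly k[2]})^`M(j) = (i == j)%:R.
Proof.
rewrite mderivX mnm1E; case: eqP => [->|_]; last by rewrite scale0r.
by rewrite scale1r -{1}[U_(j)%MM]add0m addmK mpolyX0.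
Qed.

Lemma mderiv_lsub g p j :
  (lsub g p)^`M(j) = g 0 j *: lsub g p^`M(0) + g 1 j *: lsub g p^`M(1).
Proof.
elim/mpoly_ring_ind: p => [c|i|p q IHp IHq|p q IHp IHq].
- by rewrite lsubC !mderivC /lsub comp_mpoly0 !scaler0 addr0.
- rewrite lsubX mderivD !mderivZ !mderivXU /lsub !rmorph_nat.
  case: i => [[|[|i]] lti] //; case: j => [[|[|j]] ltj] //=;
  rewrite /= ?scaler0 ?addr0 ?add0r; congr (g _ _ *: _);
    exact/val_inj.
- by rewrite lsubD !mderivD IHp IHq !lsubD; exact: addr_lin.
- by rewrite lsubM !mderivM IHp IHq !lsubD !lsubM; exact: leibniz_lin.
Qed.

End Substitution.

(** * Equivariance of transvectants *)

(** Pascal's rule. It peels one factor off the r-th power of a difference of two commuting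
    operators. *)
Lemma alternating_binomial_rec
    (R : pzRingType) (V : lmodType R) (P : nat -> V) r :
  \sum_(j < r.+2) ((-1) ^+ j * 'C(r.+1, j)%:R) *: P j =
  \sum_(j < r.+1) ((-1) ^+ j * 'C(r, j)%:R) *: P j -
  \sum_(j < r.+1) ((-1) ^+ j * 'C(r, j)%:R) *: P j.+1.
Proof.
rewrite big_ord_recl.
under eq_bigr => j _ do rewrite lift0 binS natrD mulrDr scalerDl.
rewrite big_split /= addrA [X in X + _ = _]addrC -sumrN; congr (_ + _).
  rewrite [RHS]big_ord_recl big_ord_recr /=; rewrite bin_small // mulr0 scale0r.
  by rewrite addr0 addrC !bin0.
by apply: eq_bigr => j _; rewrite exprS !mulN1r mulNr scaleNr.
Qed.

Section Transvectants.
Variable k : fieldType.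
Implicit Types (p A B : {mpoly k[2]}) (g : 'M[k]_2).

Lemma dxySl i j p : dxy i.+1 j p = dxy i j p^`M(0).
Proof. by rewrite /dxy -mderivmU1m -mderivmDm addmA -mulmS. Qed.

Lemma dxySr i j p : dxy i j.+1 p = dxy i j p^`M(1).
Proof.
by rewrite /dxy -mderivmU1m -mderivmDm mulmS !addmA [(U_(1) + _)%MM]addmC.
Qed.

Lemma dxy00 p : dxy 0 0 p = p.
Proof. by rewrite /dxy !mulm0n addm0 mderivm0m. Qed.

Lemma dxyD i j p q : dxy i j (p + q) = dxy i j p + dxy i j q.
Proof. exact: mderivmD. Qed.

Lemma dxyZ i j c p : dxy i j (c *: p) = c *: dxy i j p.
Proof. exact: mderivmZ. Qed.

(** Cayley's Omega process: the r-th power of the operator d/dx (x) d/dy - d/dy (x) d/dx applied to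
    A (x) B, followed by multiplication. Without the factorials of the transvectant it does not
    refer to the orders of the forms, which permits induction on r. *)
Definition omega (r : nat) A B : {mpoly k[2]} :=
  \sum_(j < r.+1)
    ((-1) ^+ j * 'C(r, j)%:R) *: (dxy (r - j) j A * dxy j (r - j) B).

Lemma omega0 A B : omega 0 A B = A * B.
Proof. by rewrite /omega big_ord_recl big_ord0 addr0 !dxy00 mul1r scale1r. Qed.

Lemma omegaS r A B :
  omega r.+1 A B = omega r A^`M(0) B^`M(1) - omega r A^`M(1) B^`M(0).
Proof.
rewrite /omega.
rewrite (alternating_binomial_rec
  (fun j => dxy (r.+1 - j) j A * dxy j (r.+1 - j) B)).
congr (_ - _); apply: eq_bigr => -[j /= ltj] _; congr (_ *: (_ * _)).
- by rewrite subSn // dxySl.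
- by rewrite subSn // dxySr.
- by rewrite subSS dxySr.
- by rewrite subSS dxySl.
Qed.

Lemma omegaDl r A A' B : omega r (A + A') B = omega r A B + omega r A' B.
Proof.
rewrite /omega -big_split /=; apply: eq_bigr => j _.
by rewrite dxyD mulrDl scalerDr.
Qed.

Lemma omegaDr r A B B' : omega r A (B + B') = omega r A B + omega r A B'.
Proof.
rewrite /omega -big_split /=; apply: eq_bigr => j _.
by rewrite dxyD mulrDr scalerDr.
Qed.

Lemma omegaZl r c A B : omega r (c *: A) B = c *: omega r A B.
Proof.
rewrite /omega scaler_sumr; apply: eq_bigr => j _.
by rewrite dxyZ -scalerAl !scalerA mulrC.
Qed.

Lemma omegaZr r c A B : omega r A (c *: B) = c *: omega r A B.
Proof.
rewrite /omega scaler_sumr; apply: eq_bigr => j _.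
by rewrite dxyZ -scalerAr !scalerA mulrC.
Qed.

Lemma omega_bilin r a b c d A0 A1 B0 B1 :
  omega r (a *: A0 + c *: A1) (b *: B0 + d *: B1) =
  a *: (b *: omega r A0 B0 + d *: omega r A0 B1) +
  c *: (b *: omega r A1 B0 + d *: omega r A1 B1).
Proof. by rewrite omegaDl !omegaZl !omegaDr !omegaZr. Qed.

Fact cross_cancel (V : lmodType k) (a b c d : k) (u v w z : V) :
  a *: (b *: u + d *: v) + c *: (b *: w + d *: z) -
  (b *: (a *: u + c *: v) + d *: (a *: w + c *: z)) =
  (a * d - b * c) *: (v - w).
Proof.
rewrite scalerBl !scalerBr !scalerDr !scalerA.
rewrite [b * a]mulrC [c * b]mulrC [d * c]mulrC [d * a]mulrC.
move: (_ *: u) (_ *: z) (_ *: v) (_ *: w) (_ *: v) (_ *: w) => U Z X Y X' Y'.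
rewrite opprD addrACA [U + _]addrC [Y' + Z]addrC !addrKA opprB.
by rewrite addrACA [RHS]addrACA [- X - _]addrC.
Qed.

(** By the chain rule the gradients of [lsub g A] and [lsub g B] are both multiplied by the
    transpose of g, and one step of the Omega process is a 2 x 2 determinant in these gradients, so
    each of the r steps contributes one [\det g]. *)
Lemma omega_lsub g r A B :
  omega r (lsub g A) (lsub g B) = \det g ^+ r *: lsub g (omega r A B).
Proof.
elim: r A B => [|r IHr] A B; first by rewrite !omega0 lsubM scale1r.
rewrite !omegaS !mderiv_lsub !omega_bilin !IHr cross_cancel.
by rewrite lsubB -scalerBr scalerA exprS -det2E.
Qed.

Lemma transvectantE m n r A B :
  transvectant m n r A B =
    ((m - r)`!%:R * (n - r)`!%:R / (m`!%:R * n`!%:R)) *: omega r A B.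
Proof. by []. Qed.

Lemma transvectant_lsub m n r g a b A B :
  transvectant m n r (a *: lsub g A) (b *: lsub g B) =
  (a * b * \det g ^+ r) *: lsub g (transvectant m n r A B).
Proof.
rewrite !transvectantE omegaZl omegaZr omega_lsub lsubZ !scalerA.
by congr (_ *: _); ring.
Qed.

Lemma full_transvectant_lsub r g a b A B :
  full_transvectant r (a *: lsub g A) (b *: lsub g B) =
  a * b * \det g ^+ r * full_transvectant r A B.
Proof.
by rewrite /full_transvectant transvectant_lsub mcoeffZ mcoeff0_lsub.
Qed.

End Transvectants.

(** * Invariance of the fourteen functions *)

Lemma weight_cancel (k : fieldType) (x m y D : k) n :
  m != 0 -> (m ^+ n.*2 * x) / (y * (m ^+ 2 * D) ^+ n) = x / (y * D ^+ n).
Proof.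
move=> m0; rewrite exprMn -exprM mul2n mulrCA invfM mulrA [_ * x]mulrC.
by rewrite mulfK // expf_neq0.
Qed.

Lemma weight_cancel1 (k : fieldType) (x m D : k) n :
  m != 0 -> (m ^+ n.*2 * x) / (m ^+ 2 * D) ^+ n = x / D ^+ n.
Proof. by move=> m0; rewrite -[X in _ / X]mul1r weight_cancel // mul1r. Qed.

(* The numerical coefficients play no role in homogeneity arguments, and
   computing with them is much slower than with variables. *)
Ltac hide_numerals :=
  repeat match goal with
  | |- context [@Algebra.natmul ?V ?x ?n] => generalize (@Algebra.natmul V x n)
  end; intros.

Ltac homogeneity F G :=
  hide_numerals;
  generalize (inv_D G), (inv_A F G), (inv_L F G), (inv_B1 F G), (inv_B2 F G),
    (inv_M F G), (inv_N F G), (inv_R F G), (inv_S1 F G), (inv_S2 F G),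
    (inv_S3 F G), (inv_T1 F G), (inv_T2 F G), (inv_T3 F G), (inv_W F G);
  intros; ring.

Section Weight.
Variables (k : fieldType) (F G F' G' : {mpoly k[2]}) (m : k).
Hypothesis m_neq0 : m != 0.
Hypothesis D_weight : inv_D G' = m ^+ 2 * inv_D G.
Hypothesis A_weight : inv_A F' G' = m ^+ 2 * inv_A F G.
Hypothesis L_weight : inv_L F' G' = m ^+ 3 * inv_L F G.
Hypothesis B1_weight : inv_B1 F' G' = m ^+ 2 * inv_B1 F G.
Hypothesis B2_weight : inv_B2 F' G' = m ^+ 2 * inv_B2 F G.
Hypothesis M_weight : inv_M F' G' = m ^+ 3 * inv_M F G.
Hypothesis N_weight : inv_N F' G' = m ^+ 4 * inv_N F G.
Hypothesis R_weight : inv_R F' G' = m ^+ 2 * inv_R F G.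
Hypothesis S1_weight : inv_S1 F' G' = m ^+ 3 * inv_S1 F G.
Hypothesis S2_weight : inv_S2 F' G' = m ^+ 3 * inv_S2 F G.
Hypothesis S3_weight : inv_S3 F' G' = m ^+ 3 * inv_S3 F G.
Hypothesis T1_weight : inv_T1 F' G' = m ^+ 4 * inv_T1 F G.
Hypothesis T2_weight : inv_T2 F' G' = m ^+ 4 * inv_T2 F G.
Hypothesis T3_weight : inv_T3 F' G' = m ^+ 4 * inv_T3 F G.
Hypothesis W_weight : inv_W F' G' = m ^+ 5 * inv_W F G.

Lemma P1_weight : P1 F' G' = m ^+ 2 * P1 F G.
Proof.
rewrite /P1 A_weight.
homogeneity F G.
Qed.

Lemma P2_weight : P2 F' G' = m ^+ 6 * P2 F G.
Proof.
rewrite /P2 D_weight A_weight L_weight B1_weight B2_weight N_weight.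
homogeneity F G.
Qed.

Lemma P3_weight : P3 F' G' = m ^+ 8 * P3 F G.
Proof.
rewrite /P3 D_weight A_weight L_weight B1_weight B2_weight M_weight N_weight
  R_weight T1_weight T2_weight T3_weight.
homogeneity F G.
Qed.

Lemma P4_weight : P4 F' G' = m ^+ 6 * P4 F G.
Proof.
rewrite /P4 D_weight A_weight L_weight B1_weight B2_weight N_weight.
homogeneity F G.
Qed.

Lemma P5_weight : P5 F' G' = m ^+ 8 * P5 F G.
Proof.
rewrite /P5 D_weight A_weight L_weight B1_weight B2_weight M_weight N_weight
  R_weight T1_weight T2_weight T3_weight.
homogeneity F G.
Qed.

Lemma P6_weight : P6 F' G' = m ^+ 12 * P6 F G.
Proof.
rewrite /P6 D_weight A_weight L_weight B1_weight B2_weight M_weight N_weight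
  S1_weight S2_weight S3_weight W_weight.
homogeneity F G.
Qed.

Lemma Q_e2_weight : Q_e2 F' G' = m ^+ 6 * Q_e2 F G.
Proof.
rewrite /Q_e2 L_weight.
homogeneity F G.
Qed.

Lemma Q_p02_weight : Q_p02 F' G' = m ^+ 6 * Q_p02 F G.
Proof.
rewrite /Q_p02 D_weight A_weight L_weight B1_weight B2_weight N_weight.
homogeneity F G.
Qed.

Lemma Q_p12_weight : Q_p12 F' G' = m ^+ 8 * Q_p12 F G.
Proof.
rewrite /Q_p12 D_weight A_weight L_weight B1_weight B2_weight M_weight N_weight
  R_weight T1_weight T2_weight T3_weight.
homogeneity F G.
Qed.

Lemma Q_p03_weight : Q_p03 F' G' = m ^+ 8 * Q_p03 F G.
Proof.
rewrite /Q_p03 D_weight A_weight L_weight B1_weight B2_weight M_weight N_weight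
  R_weight T1_weight T2_weight T3_weight.
homogeneity F G.
Qed.

Lemma Q_w2_weight : Q_w2 F' G' = m ^+ 8 * Q_w2 F G.
Proof.
rewrite /Q_w2 D_weight A_weight L_weight M_weight.
homogeneity F G.
Qed.

Lemma Q_w21_weight : Q_w21 F' G' = m ^+ 12 * Q_w21 F G.
Proof.
rewrite /Q_w21 D_weight A_weight L_weight B1_weight B2_weight M_weight N_weight
  S1_weight S2_weight S3_weight W_weight.
homogeneity F G.
Qed.

Lemma Q_w12_weight : Q_w12 F' G' = m ^+ 12 * Q_w12 F G.
Proof.
rewrite /Q_w12 D_weight A_weight L_weight B1_weight B2_weight M_weight N_weight
  S1_weight S2_weight S3_weight W_weight.
homogeneity F G.
Qed.

Lemma Q_w03_weight : Q_w03 F' G' = m ^+ 12 * Q_w03 F G.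
Proof.
rewrite /Q_w03 D_weight A_weight L_weight B1_weight B2_weight M_weight N_weight
  S1_weight S2_weight S3_weight W_weight.
homogeneity F G.
Qed.

Lemma U1_weight : U1 F' G' = U1 F G.
Proof.
rewrite /U1 P1_weight D_weight; hide_numerals.
exact: (weight_cancel _ _ _ 1).
Qed.

Lemma U2_weight : U2 F' G' = U2 F G.
Proof.
rewrite /U2 P2_weight D_weight; hide_numerals.
exact: (weight_cancel _ _ _ 3).
Qed.

Lemma U3_weight : U3 F' G' = U3 F G.
Proof.
rewrite /U3 P3_weight D_weight; hide_numerals.
exact: (weight_cancel _ _ _ 4).
Qed.

Lemma U4_weight : U4 F' G' = U4 F G.
Proof.
rewrite /U4 P4_weight D_weight; hide_numerals.
exact: (weight_cancel _ _ _ 3).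
Qed.

Lemma U5_weight : U5 F' G' = U5 F G.
Proof.
rewrite /U5 P5_weight D_weight; hide_numerals.
exact: (weight_cancel _ _ _ 4).
Qed.

Lemma U6_weight : U6 F' G' = U6 F G.
Proof.
rewrite /U6 P6_weight D_weight; hide_numerals.
exact: (weight_cancel _ _ _ 6).
Qed.

Lemma fourteen_functions_weight :
  fourteen_functions F' G' = fourteen_functions F G.
Proof.
rewrite /fourteen_functions U1_weight U2_weight U3_weight U4_weight U5_weight.
rewrite U6_weight D_weight Q_e2_weight Q_p02_weight Q_p12_weight Q_p03_weight.
rewrite Q_w2_weight Q_w21_weight Q_w12_weight Q_w03_weight.
move: (Q_e2 F G) (Q_p02 F G) (Q_p12 F G) (Q_p03 F G) => e2 p02 p12 p03.
move: (Q_w2 F G) (Q_w21 F G) (Q_w12 F G) (Q_w03 F G) => w2 w21 w12 w03.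
by rewrite !(weight_cancel1 _ _ 3 m_neq0) !(weight_cancel1 _ _ 4 m_neq0)
  !(weight_cancel1 _ _ 6 m_neq0).
Qed.

End Weight.

Section Invariance.
Variables (k : fieldType) (g : 'M[k]_2) (a : k) (F G : {mpoly k[2]}).

Lemma mul_lsub b c p q :
  (b *: lsub g p) * (c *: lsub g q) = (b * c) *: lsub g (p * q).
Proof. by rewrite -scalerAl -scalerAr scalerA -lsubM. Qed.

Lemma exp_lsub b p n : (b *: lsub g p) ^+ n = b ^+ n *: lsub g (p ^+ n).
Proof. by rewrite exprZn lsubXn. Qed.

Local Notation d := (\det g).
Local Notation F' := (a *: lsub g F).
Local Notation G' := ((a * d) *: lsub g G).
Local Notation mu := (a ^+ 2 * d ^+ 5).

Let cov_lsubE :=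
  (transvectant_lsub, full_transvectant_lsub, mul_lsub, exp_lsub).

(** One count covers all the invariants below. In degree i in F and j in G, the scalars contribute
    a^(i+j) d^j. The orders 5i + 3j are used up two at a time by transvection, which contributes
    d^((5i+3j)/2). The product is [mu] to the power (i+j)/2. *)
Lemma inv_D_lsub : inv_D G' = mu ^+ 2 * inv_D G.
Proof. by rewrite /inv_D /cov_h !cov_lsubE; ring. Qed.

Lemma inv_A_lsub : inv_A F' G' = mu ^+ 2 * inv_A F G.
Proof. by rewrite /inv_A /cov_h !cov_lsubE; ring. Qed.

Lemma inv_L_lsub : inv_L F' G' = mu ^+ 3 * inv_L F G.
Proof. by rewrite /inv_L /cov_q /cov_h !cov_lsubE; ring. Qed.

Lemma inv_B1_lsub : inv_B1 F' G' = mu ^+ 2 * inv_B1 F G.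
Proof. by rewrite /inv_B1 /cov_i /cov_h !cov_lsubE; ring. Qed.

Lemma inv_B2_lsub : inv_B2 F' G' = mu ^+ 2 * inv_B2 F G.
Proof. by rewrite /inv_B2 /cov_H !cov_lsubE; ring. Qed.

Lemma inv_M_lsub : inv_M F' G' = mu ^+ 3 * inv_M F G.
Proof. by rewrite /inv_M /cov_H /cov_q /cov_h !cov_lsubE; ring. Qed.

Lemma inv_N_lsub : inv_N F' G' = mu ^+ 4 * inv_N F G.
Proof. by rewrite /inv_N /cov_H /cov_q /cov_h !cov_lsubE; ring. Qed.

Lemma inv_R_lsub : inv_R F' G' = mu ^+ 2 * inv_R F G.
Proof. by rewrite /inv_R /cov_c33 /cov_i !cov_lsubE; ring. Qed.

Lemma inv_S1_lsub : inv_S1 F' G' = mu ^+ 3 * inv_S1 F G.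
Proof. by rewrite /inv_S1 /cov_c33 /cov_i /cov_q /cov_h !cov_lsubE; ring. Qed.

Lemma inv_S2_lsub : inv_S2 F' G' = mu ^+ 3 * inv_S2 F G.
Proof. by rewrite /inv_S2 /cov_c35 /cov_i /cov_h !cov_lsubE; ring. Qed.

Lemma inv_S3_lsub : inv_S3 F' G' = mu ^+ 3 * inv_S3 F G.
Proof. by rewrite /inv_S3 /cov_t /cov_H !cov_lsubE; ring. Qed.

Lemma inv_T1_lsub : inv_T1 F' G' = mu ^+ 4 * inv_T1 F G.
Proof. by rewrite /inv_T1 /cov_c35 /cov_i /cov_q /cov_h !cov_lsubE; ring. Qed.

Lemma inv_T2_lsub : inv_T2 F' G' = mu ^+ 4 * inv_T2 F G.
Proof. by rewrite /inv_T2 /cov_t /cov_H /cov_q /cov_h !cov_lsubE; ring. Qed.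

Lemma inv_T3_lsub : inv_T3 F' G' = mu ^+ 4 * inv_T3 F G.
Proof. by rewrite /inv_T3 !cov_lsubE; ring. Qed.

Lemma inv_W_lsub : inv_W F' G' = mu ^+ 5 * inv_W F G.
Proof. by rewrite /inv_W /cov_q /cov_h !cov_lsubE; ring. Qed.

Lemma fourteen_functions_lsub : a != 0 -> d != 0 ->
  fourteen_functions F' G' = fourteen_functions F G.
Proof.
move=> a0 d0; have mu0 : mu != 0 by rewrite mulf_neq0 ?expf_neq0.
exact: (fourteen_functions_weight mu0 inv_D_lsub inv_A_lsub inv_L_lsub
  inv_B1_lsub inv_B2_lsub inv_M_lsub inv_N_lsub inv_R_lsub inv_S1_lsub
  inv_S2_lsub inv_S3_lsub inv_T1_lsub inv_T2_lsub inv_T3_lsub inv_W_lsub).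
Qed.

End Invariance.

(** * Clebsch-Gordan pairs and conjugation *)

Lemma sum2E (V : nmodType) (F : 'I_2 -> V) : \sum_(i < 2) F i = F 0 + F 1.
Proof. by rewrite !big_ord_recl big_ord0 addr0 lift01. Qed.

(** Cramer's rule read backwards: g is [\det g] times the adjugate of its inverse. This makes the
    transformation of the quintic an identity in the entries of the inverse alone. *)
Lemma invmx2E (k : fieldType) (g : 'M[k]_2) (h := invmx g) : g \in unitmx ->
  [/\ g 1 1 = \det g * h 0 0, g 0 1 = - (\det g * h 0 1),
      g 1 0 = - (\det g * h 1 0) & g 0 0 = \det g * h 1 1].
Proof.
move=> gu; have /matrixP gh1 : g *m h = 1%:M by rewrite mulmxV.
have := (gh1 0 0, gh1 0 1, gh1 1 0, gh1 1 1); rewrite !mxE !sum2E /= det2E.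
move: (h 0 0) (h 0 1) (h 1 0) (h 1 1) (g 0 0) (g 0 1) (g 1 0) (g 1 1).
move=> h00 h01 h10 h11 a b c d [[[e00 e01] e10] e11].
split.
- have -> : (a * d - b * c) * h00 =
      d * (a * h00 + b * h10) - b * (c * h00 + d * h10) by ring.
  by rewrite e00 e10 mulr1 mulr0 subr0.
- have -> : (a * d - b * c) * h01 =
      d * (a * h01 + b * h11) - b * (c * h01 + d * h11) by ring.
  by rewrite e01 e11 mulr1 mulr0 sub0r opprK.
- have -> : (a * d - b * c) * h10 =
      a * (c * h00 + d * h10) - c * (a * h00 + b * h10) by ring.
  by rewrite e00 e10 mulr1 mulr0 sub0r opprK.
- have -> : (a * d - b * c) * h11 =
      a * (c * h01 + d * h11) - c * (a * h01 + b * h11) by ring.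
  by rewrite e01 e11 mulr1 mulr0 subr0.
Qed.

Section ClebschGordan.
Variable k : fieldType.
Implicit Types (p A B : {mpoly k[2]}) (g : 'M[k]_2) (f : 'I_2 -> {mpoly k[2]}).

Lemma postcomp_precompE g f i :
  postcomp (invmx g) (precomp g f) i =
    invmx g i 0 *: lsub g (f 0) + invmx g i 1 *: lsub g (f 1).
Proof. by rewrite /postcomp sum2E. Qed.

Fact CG_quintic_scale (V : algType k) (x y p q : V) (c d h00 h01 h10 h11 : k) :
  y * (c *: (h00 *: p + h01 *: q)) - x * (c *: (h10 *: p + h11 *: q)) =
  c *: (y * (h00 *: p + h01 *: q) - x * (h10 *: p + h11 *: q)).
Proof. by rewrite -!scalerAr -scalerBr. Qed.

Fact CG_quintic_adj (V : algType k) (x y p q : V) (d h00 h01 h10 h11 : k) :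
  (- (d * h10) *: x + (d * h00) *: y) * p -
    ((d * h11) *: x + - (d * h01) *: y) * q =
  d *: (y * (h00 *: p + h01 *: q) - x * (h10 *: p + h11 *: q)).
Proof.
rewrite !mulrDl !mulrDr -!scalerAl -!scalerAr scalerBr !scalerDr !scalerA.
by rewrite !scaleNr opprB [- _ + _]addrC addrACA -opprD.
Qed.

Fact CG_cubic_lin (V : lmodType k) (A B C D : V)
    (h00 h01 h10 h11 a b c d : k) :
  h00 *: (a *: A + c *: B) + h01 *: (a *: C + c *: D) +
  (h10 *: (b *: A + d *: B) + h11 *: (b *: C + d *: D)) =
  (a * h00 + b * h10) *: A + (c * h00 + d * h10) *: B +
  ((a * h01 + b * h11) *: C + (c * h01 + d * h11) *: D).
Proof.
rewrite !scalerDr !scalerA addrACA [X in X + _]addrACA [X in _ + X]addrACA.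
rewrite -!scalerDl ![h00 * _]mulrC ![h01 * _]mulrC.
by rewrite ![h10 * _]mulrC ![h11 * _]mulrC.
Qed.

(** View f as a vector field on the plane, transformed into g^-1 f(g X). The quintic is the
    determinant of the columns f(X) and X; writing X as g^-1 (g X) pulls out 1 / det g. The cubic is
    the divergence, the trace of a Jacobian matrix that is merely conjugated by g. *)
Lemma CG_conj g c f f' : g \in unitmx ->
    (forall i, f' i = c *: postcomp (invmx g) (precomp g f) i) ->
  CG_quintic f' = (c / \det g) *: lsub g (CG_quintic f) /\
  CG_cubic f' = c *: lsub g (CG_cubic f).
Proof.
move=> gu f'E; have d0 : \det g != 0 by rewrite -unitfE -unitmxE.
rewrite /CG_quintic /CG_cubic !f'E !postcomp_precompE; split.
  have [e11 e01 e10 e00] := invmx2E gu.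
  rewrite lsubB !lsubM !lsubX {1}e11 {1}e01 {1}e10 {1}e00.
  rewrite CG_quintic_adj scalerA mulfVK //.
  exact: CG_quintic_scale.
have /matrixP gh1 : g *m invmx g = 1%:M by rewrite mulmxV.
have := (gh1 0 0, gh1 0 1, gh1 1 0, gh1 1 1); rewrite !mxE !sum2E /=.
case=> [[[e00 e01] e10] e11].
rewrite !mderivZ !mderivD !mderivZ !mderiv_lsub -scalerDr CG_cubic_lin.
by rewrite e00 e01 e10 e11 !scale1r !scale0r addr0 add0r lsubD.
Qed.

Lemma mulXU_mderivX (i : 'I_2) (m : 'X_{1..2}) :
  'X_i * ('X_[m] : {mpoly k[2]})^`M(i) = (m i)%:R *: 'X_[m].
Proof.
rewrite mderivX -scalerAr; have [->|mi_neq0] := eqVneq (m i) 0%N.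
  by rewrite !scale0r.
rewrite -mpolyXD addmC submK //; apply/mnm_lepP => j; rewrite mnm1E.
by case: eqP => [<-|_] //; rewrite lt0n.
Qed.

(** Euler's identity monomial by monomial, so that it holds for inhomogeneous polynomials too. *)
Lemma mcoeff_euler p (m : 'X_{1..2}) :
  ('X_0 * p^`M(0) + 'X_1 * p^`M(1))@_m = (m 0 + m 1)%:R * p@_m.
Proof.
elim/mpolyind: p => [|c m' p _ _ IHp].
  by rewrite !mderiv0 !mulr0 addr0 !mcoeff0 mulr0.
rewrite !mderivD !mderivZ !mulrDr addrACA mcoeffD IHp [in RHS]mcoeffD mulrDr.
congr (_ + _); rewrite -!scalerAr !mulXU_mderivX mcoeffD !mcoeffZ !mcoeffX.
case: eqP => [->|_]; rewrite ?mulr0 ?addr0 //.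
by rewrite !mulr1 natrD mulrDl ![c * _]mulrC.
Qed.

(* If [y * u = x * v] and [u_x + v_y = 0], differentiating the first equation
   with respect to y gives [u + x u_x + y u_y = 0], hence [u = 0]. *)
Lemma CG_inj f f' : [pchar k] =i pred0 ->
  CG_quintic f = CG_quintic f' -> CG_cubic f = CG_cubic f' ->
  f 0 = f' 0 /\ f 1 = f' 1.
Proof.
move=> char0 eF eG; set u := f 0 - f' 0; set v := f 1 - f' 1.
have euv : 'X_1 * u = 'X_0 * v.
  have := eF; rewrite /CG_quintic => /(canRL (subrK _)) e.
  apply/eqP; rewrite /u /v !mulrBr subr_eq e; apply/eqP.
  by rewrite -addrA [LHS]addrC [- _ + _]addrC.
have div0 : u^`M(0) = - v^`M(1).
  apply/eqP; rewrite -subr_eq0 opprK /u /v !mderivB addrACA -opprD subr_eq0.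
  exact/eqP.
have u0 : u = 0.
  have euler0 : u + ('X_0 * u^`M(0) + 'X_1 * u^`M(1)) = 0.
    have := congr1 (mderiv 1) euv.
    rewrite !mderivM !mderivXU /= mul1r mul0r add0r => e.
    by rewrite addrCA e div0 mulrN addNr.
  apply/mpolyP => m; have := congr1 (mcoeff m) euler0.
  (* The coefficient of u at m gets multiplied by deg m + 1, a positive integer, which is nonzero in
     characteristic zero. *)
  rewrite mcoeffD mcoeff_euler mcoeff0 -{1}[u@_m]mul1r -mulrDl -mulrS.
  by move/eqP; rewrite mulf_eq0 ((pcharf0P k).1 char0) /= => /eqP.
have v0 : v = 0.
  apply/mpolyP => m; have := congr1 (mcoeff (U_(0%R : 'I_2) + m)%MM) euv.
  by rewrite u0 mulr0 mulrC mcoeffMX !mcoeff0.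
by split; apply/eqP; rewrite -subr_eq0; apply/eqP.
Qed.

(* The Clebsch-Gordan pair of the representative c * (g^-1 o phi o g) of a
   conjugate of phi is related to that of phi by g and a = c / det g. *)
Definition CG_equiv (F G F' G' : {mpoly k[2]}) : Prop :=
  exists g a, [/\ \det g != 0, a != 0,
    F' = a *: lsub g F & G' = (a * \det g) *: lsub g G].

Lemma CG_equiv_sym F G F' G' : CG_equiv F G F' G' -> CG_equiv F' G' F G.
Proof.
case=> g [a [g0 a0 -> ->]]; have gu : g \in unitmx by rewrite unitmxE unitfE.
exists (invmx g), a^-1.
rewrite det_inv !invr_eq0 !lsubZ -!lsub_mulmx mulmxV // !lsub1.
by split; rewrite // scalerA -?invfM mulVf ?mulf_neq0 ?scale1r.
Qed.

Lemma CG_equiv_trans F1 G1 F2 G2 F3 G3 :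
  CG_equiv F1 G1 F2 G2 -> CG_equiv F2 G2 F3 G3 -> CG_equiv F1 G1 F3 G3.
Proof.
case=> g [a [g0 a0 -> ->]] [h [b [h0 b0 -> ->]]].
exists (g *m h), (b * a); split.
- by rewrite det_mulmx mulf_neq0.
- by rewrite mulf_neq0.
- by rewrite lsub_mulmx lsubZ scalerA.
- rewrite lsub_mulmx lsubZ scalerA det_mulmx; congr (_ *: _); ring.
Qed.

Lemma conjugate_CG_equiv d (phi psi : ratmap k d) : [pchar k] =i pred0 ->
  conjugate phi psi <->
  CG_equiv (CG_quintic phi) (CG_cubic phi) (CG_quintic psi) (CG_cubic psi).
Proof.
move=> char0; split=> [[g gu [c c0 psiE]]|[g [a [d0 a0 eF eG]]]].
  have d0 : \det g != 0 by rewrite -unitfE -unitmxE.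
  have [eF eG] := CG_conj gu psiE.
  by exists g, (c / \det g); rewrite divfK // mulf_neq0 ?invr_eq0.
have gu : g \in unitmx by rewrite unitmxE unitfE.
(* By [CG_conj] the scalar of the representative is the factor of the cubic. The representative
   built with it has the same pair as psi, so [CG_inj] identifies the two. *)
exists g => //; exists (a * \det g); first by rewrite mulf_neq0.
pose f i := (a * \det g) *: postcomp (invmx g) (precomp g phi) i.
have [] := @CG_conj g (a * \det g) phi f gu (fun=> erefl).
rewrite mulfK // -eF -eG => eF' eG'.
have [e0 e1] := CG_inj char0 eF' eG'.
case=> [[|[|i]] lti] //; rewrite -/(f _).
  by rewrite (_ : Ordinal lti = 0) ?e0 //; apply/val_inj.
by rewrite (_ : Ordinal lti = 1) ?e1 //; apply/val_inj.
Qed.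

Lemma fourteen_functions_equiv (F G F' G' : {mpoly k[2]}) :
  CG_equiv F G F' G' -> fourteen_functions F' G' = fourteen_functions F G.
Proof. by case=> g [a [d0 a0 -> ->]]; exact: fourteen_functions_lsub. Qed.

End ClebschGordan.

(** * Forms given by lists of coefficients *)

Section Forms.
Variable k : fieldType.
Implicit Types (s t : seq k) (p : {mpoly k[2]}).

(* Lists of coefficients are padded with zeros, so that a form has several
   representatives. *)
Definition form (n : nat) s : {mpoly k[2]} :=
  \sum_(i < n.+1) s`_i *: ('X_0 ^+ (n - i) * 'X_1 ^+ i).

Fixpoint adds s t :=
  match s, t with
  | [::], _ => t
  | _, [::] => s
  | a :: s', b :: t' => a + b :: adds s' t'
  end.

Definition scales c s := [seq c * a | a <- s].

Fixpoint muls s t :=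
  if s is c :: s' then adds (scales c t) (0 :: muls s' t) else [::].

Definition dxs n s := mkseq (fun i => (n - i)%:R * s`_i) n.
Definition dys n s := mkseq (fun i => i.+1%:R * s`_i.+1) n.

(** The recursion of [omegaS] on coefficient lists. The orders m and n are carried along because a
    list may omit trailing zeros, whereas differentiating in x needs the order. *)
Fixpoint omegas r m n s t :=
  if r is r'.+1 then
    adds (omegas r' m.-1 n.-1 (dxs m s) (dys n t))
         (scales (- 1) (omegas r' m.-1 n.-1 (dys m s) (dxs n t)))
  else muls s t.

Lemma nth_adds s t i : (adds s t)`_i = s`_i + t`_i.
Proof.
by elim: s t i => [|a s IHs] [|b t] [|i] //=; rewrite ?nth_nil ?add0r ?addr0.
Qed.

Lemma nth_scales c s i : (scales c s)`_i = c * s`_i.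
Proof.
have [lt_is|le_si] := ltnP i (size s); first exact: nth_map.
by rewrite !nth_default ?mulr0 // size_map.
Qed.

Lemma form_adds n s t : form n (adds s t) = form n s + form n t.
Proof.
by rewrite /form -big_split; apply: eq_bigr => i _; rewrite nth_adds scalerDl.
Qed.

Lemma form_scales n c s : form n (scales c s) = c *: form n s.
Proof.
by rewrite /form scaler_sumr; apply: eq_bigr => i _; rewrite nth_scales scalerA.
Qed.

Lemma eq_form n s t :
  (forall i, (i <= n)%N -> s`_i = t`_i) -> form n s = form n t.
Proof. by move=> st; apply: eq_bigr => i _; rewrite st // -ltnS. Qed.

Lemma form0 n s : (forall i, (i <= n)%N -> s`_i = 0) -> form n s = 0.
Proof. by move=> s0; apply: big1 => i _; rewrite s0 ?scale0r // -ltnS. Qed.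

Lemma form_nil n : form n [::] = 0.
Proof. by apply: form0 => i _; rewrite nth_nil. Qed.

Lemma form_cons n a s :
  form n.+1 (a :: s) = a *: 'X_0 ^+ n.+1 + 'X_1 * form n s.
Proof.
rewrite /form big_ord_recl subn0 expr0 mulr1 mulr_sumr; congr (_ + _).
by apply: eq_bigr => i _; rewrite lift0 subSS exprS mulrCA -scalerAr.
Qed.

Lemma mulX0_form n s : (size s <= n.+1)%N -> 'X_0 * form n s = form n.+1 s.
Proof.
move=> ns; rewrite /form [RHS]big_ord_recr /= nth_default // scale0r addr0.
rewrite mulr_sumr; apply: eq_bigr => i _.
by rewrite -scalerAr mulrA -exprS subSn // -ltnS.
Qed.

Lemma mulX0n_form m n s :
  (size s <= n.+1)%N -> 'X_0 ^+ m * form n s = form (m + n) s.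
Proof.
move=> ns; elim: m => [|m IHm]; first by rewrite mul1r.
rewrite exprS -mulrA IHm mulX0_form //.
by rewrite (leq_trans ns) // ltnS leq_addl.
Qed.

Lemma form_muls m n s t : (size s <= m.+1)%N -> (size t <= n.+1)%N ->
  form m s * form n t = form (m + n) (muls s t).
Proof.
move=> ms nt; elim: s m ms => [|a s IHs] [|m] ms.
- by rewrite /= !form_nil mul0r.
- by rewrite /= !form_nil mul0r.
- case: s ms IHs => // _ _; rewrite /= form_adds form_scales add0n.
  rewrite [X in _ + X]form0 ?addr0 => [|[|i] _]; rewrite /= ?nth_nil //.
  rewrite /form big_ord_recl big_ord0 addr0 subn0 !expr0 mulr1.
  by rewrite -scalerAl mul1r.
rewrite form_cons mulrDl -scalerAl mulX0n_form // -mulrA IHs // /= form_adds.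
by rewrite form_scales addSn form_cons scale0r add0r.
Qed.

Lemma mderivXn (i j : 'I_2) n :
  ('X_i ^+ n : {mpoly k[2]})^`M(j) = ((i == j) * n)%:R *: 'X_i ^+ n.-1.
Proof.
rewrite mpolyXn mderivX mulmnE mnm1E; have [->|_] := eqVneq i j; last first.
  by rewrite !mul0n !scale0r.
case: n => [|n]; first by rewrite !scale0r.
by rewrite mpolyXn mulmSr addmK.
Qed.

Lemma mderiv0_monomial a b :
  ('X_0 ^+ a * 'X_1 ^+ b : {mpoly k[2]})^`M(0) =
  a%:R *: ('X_0 ^+ a.-1 * 'X_1 ^+ b).
Proof.
by rewrite mderivM !mderivXn /= !mul1n mul0n scale0r mulr0 addr0 -scalerAl.
Qed.

Lemma mderiv1_monomial a b :
  ('X_0 ^+ a * 'X_1 ^+ b : {mpoly k[2]})^`M(1) =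
  b%:R *: ('X_0 ^+ a * 'X_1 ^+ b.-1).
Proof.
by rewrite mderivM !mderivXn /= !mul1n mul0n scale0r mul0r add0r -scalerAr.
Qed.

Lemma mderiv0_form n s : (0 < n)%N -> (form n s)^`M(0) = form n.-1 (dxs n s).
Proof.
case: n => // n _; rewrite /form raddf_sum big_ord_recr /= mderivZ.
rewrite mderiv0_monomial subnn scale0r scaler0 addr0.
apply: eq_bigr => i _; rewrite mderivZ mderiv0_monomial nth_mkseq //= scalerA.
by rewrite [s`_i * _]mulrC subSn // -ltnS.
Qed.

Lemma mderiv1_form n s : (0 < n)%N -> (form n s)^`M(1) = form n.-1 (dys n s).
Proof.
case: n => // n _; rewrite /form raddf_sum big_ord_recl /= mderivZ.
rewrite mderiv1_monomial scale0r scaler0 add0r.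
apply: eq_bigr => i _; rewrite mderivZ mderiv1_monomial nth_mkseq //.
by rewrite /bump leq0n add1n scalerA subSS [s`_(i.+1) * _]mulrC.
Qed.

Lemma omega_form r m n s t : (r <= m)%N -> (r <= n)%N ->
    (size s <= m.+1)%N -> (size t <= n.+1)%N ->
  omega r (form m s) (form n t) = form (m + n - r.*2) (omegas r m n s t).
Proof.
elim: r m n s t => [|r IHr] m n s t rm rn ms nt.
  by rewrite omega0 form_muls // subn0.
case: m n rm rn ms nt => [|m] [|n] // rm rn ms nt.
rewrite omegaS !mderiv0_form // !mderiv1_form // /= !IHr ?size_mkseq //.
by rewrite form_adds form_scales scaleN1r addSn addnS doubleS !subSS.
Qed.

Lemma transvectant_form r m n s t : [pchar k] =i pred0 ->
    (r <= m)%N -> (r <= n)%N -> (size s <= m.+1)%N -> (size t <= n.+1)%N ->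
  transvectant m n r (form m s) (form n t) =
  form (m + n - r.*2)
    (scales ((m ^_ r)%:R * (n ^_ r)%:R)^-1 (omegas r m n s t)).
Proof.
move=> /(pcharf0P k).1 char0 rm rn ms nt.
rewrite transvectantE omega_form // form_scales; congr (_ *: _).
rewrite -(ffact_fact rm) -(ffact_fact rn) !natrM.
have factN0 i : i`!%:R != 0 :> k by rewrite char0 -lt0n fact_gt0.
have ffactN0 i : (r <= i)%N -> (i ^_ r)%:R != 0 :> k.
  by rewrite char0 -lt0n ffact_gt0.
by field; rewrite ?factN0 ?ffactN0.
Qed.

Definition expos (i j : nat) : 'X_{1..2} :=
  (U_(0%R : 'I_2) *+ i + U_(1%R : 'I_2) *+ j)%MM.

Lemma monomialE i j : 'X_0 ^+ i * 'X_1 ^+ j = 'X_[expos i j] :> {mpoly k[2]}.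
Proof. by rewrite mpolyXD !mpolyXn. Qed.

Lemma expos0 i j : expos i j 0 = i.
Proof. by rewrite mnmDE !mulmnE !mnm1E /= mul1n mul0n addn0. Qed.

Lemma expos1 i j : expos i j 1 = j.
Proof. by rewrite mnmDE !mulmnE !mnm1E /= mul1n mul0n. Qed.

Lemma mcoeff_form n s i : (i <= n)%N -> (form n s)@_(expos (n - i) i) = s`_i.
Proof.
move=> le_in; rewrite /form raddf_sum.
rewrite (bigD1 (Ordinal (le_in : i < n.+1)%N)) //=.
rewrite mcoeffZ monomialE mcoeffX eqxx mulr1 big1 ?addr0 // => j ji.
rewrite mcoeffZ monomialE mcoeffX; case: eqP => [e|_]; last by rewrite mulr0.
by case/eqP: ji; apply/val_inj; rewrite /= -(expos1 (n - j) j) e expos1.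
Qed.

Lemma mcoeff0_dxy i j p : (dxy i j p)@_0 = p@_(expos i j) *+ (i`! * j`!).
Proof.
rewrite /dxy mcoeff_mderivm -/(expos i j) addm0; congr (_ *+ _).
by rewrite !big_ord_recl big_ord0 muln1 lift01 expos0 expos1 !ffactnn.
Qed.

(** The classical apolar pairing of two forms of order r. A fold over an explicit list of indices,
    unlike a big operator, unfolds by mere evaluation. *)
Definition pairing r s t :=
  foldr (fun j c => ((-1) ^+ j / 'C(r, j)%:R) * (s`_j * t`_(r - j)) + c)
    0 (iota 0 r.+1).

Lemma full_transvectant_form r s t : [pchar k] =i pred0 ->
  full_transvectant r (form r s) (form r t) = pairing r s t.
Proof.
have -> : pairing r s t =
    \sum_(0 <= j < r.+1) ((-1) ^+ j / 'C(r, j)%:R) * (s`_j * t`_(r - j)).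
  by rewrite unlock /index_iota subn0.
rewrite big_mkord => /(pcharf0P k).1 char0; have factN0 n : n`!%:R != 0 :> k.
  by rewrite char0 -lt0n fact_gt0.
rewrite /full_transvectant transvectantE mcoeffZ /omega raddf_sum mulr_sumr.
apply: eq_bigr => j _; have le_jr : (j <= r)%N by rewrite -ltnS.
rewrite /= mcoeffZ rmorphM /= !mcoeff0_dxy mcoeff_form //.
rewrite -[X in expos X _](subKn le_jr) mcoeff_form ?leq_subr //.
rewrite subnn fact0 -[s`_j *+ _]mulr_natr -[t`_(r - j) *+ _]mulr_natr.
rewrite -(bin_fact le_jr) !natrM.
have C0 : 'C(r, j)%:R != 0 :> k by rewrite char0 -lt0n bin_gt0.
move: (s`_j) (t`_(r - j)) ((-1) ^+ j) => a b e.
have := (factN0 j, factN0 (r - j)%N) => -[fj frj].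
by field; rewrite ?C0 ?fj ?frj.
Qed.

End Forms.

(** * Values at the normal form *)

Ltac eval_coefs :=
  cbv [omegas adds scales muls dxs dys mkseq map iota nth pairing foldr binomial
       subn Nat.sub falling_factorial ffact_rec muln Nat.mul addn Nat.add
       Nat.pred].

(* Coordinates adapted to the group S_3 of symmetries of x^3 + y^3, generated by
   y -> z y (z a cube root of unity) and the exchange of x and y: s is fixed, e
   is multiplied by the sign, and (u1, u2), (v1, v2) are multiplied by
   (z, z^-1), or exchanged. *)
Definition quintic (k : fieldType) (e s u1 u2 v1 v2 : k) : {mpoly k[2]} :=
  form 5 [:: - u2; 5%:R * (e + s); 10%:R * v1; 10%:R * - v2;
    5%:R * (e - s); u1].

Section Values.
Variables (k : fieldType) (char0 : [pchar k] =i pred0).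

Lemma natS_neq0 n : n.+1%:R != 0 :> k.
Proof. by rewrite ((pcharf0P k).1 char0). Qed.

(** Used to split a denominator into a small factor c and a factor d that is cancelled at once; d
    contains 1001, the denominator of T3 and W, which stems from the binomials C(15, j) in their
    pairings. *)
Lemma eq_div_mul (b c d x y : k) :
  b = c * d -> c != 0 -> d != 0 -> x = y * d -> x / b = y / c.
Proof. by move=> -> c0 d0 ->; rewrite -mulf_div divff // mulr1. Qed.

Ltac char0_field := field; rewrite ?oner_neq0 ?natS_neq0 //.
(** Sixteen case distinctions reach every coefficient up to order 15, the largest order in use. *)
Ltac eval_form :=
  apply: eq_form; do 16? [case=> [_|]]; rewrite ?ltnS //; eval_coefs;
  char0_field.

Local Notation G := (form 3 [:: 1; 0; 0; 1] : {mpoly k[2]}).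

Lemma cov_hE : cov_h G = form 2 [:: 0; 2%:R; 0].
Proof. by rewrite /cov_h (transvectant_form char0) //; eval_form. Qed.

Lemma cov_qE : cov_q G = form 3 [:: 1; 0; 0; - 1].
Proof. by rewrite /cov_q cov_hE (transvectant_form char0) //; eval_form. Qed.

(** * Covariants of a general quintic with binomially normalized coefficients *)

Section Covariants.
Variables a0 a1 a2 a3 a4 a5 : k.
Local Notation F :=
  (form 5 [:: a0; 5%:R * a1; 10%:R * a2; 10%:R * a3; 5%:R * a4; a5]).

Lemma cov_iE : cov_i F = form 2
  [:: 2%:R * a0 * a4 + 6%:R * a2 ^+ 2 - 8%:R * a1 * a3;
      2%:R * a0 * a5 + 4%:R * a2 * a3 - 6%:R * a1 * a4;
      2%:R * a1 * a5 + 6%:R * a3 ^+ 2 - 8%:R * a2 * a4].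
Proof. rewrite /cov_i (transvectant_form char0) //; eval_form. Qed.

Lemma cov_HE : cov_H F = form 6
  [:: 2%:R * a0 * a2 - 2%:R * a1 ^+ 2;
      6%:R * a0 * a3 - 6%:R * a1 * a2;
      6%:R * a0 * a4 + 6%:R * a1 * a3 - 12%:R * a2 ^+ 2;
      2%:R * a0 * a5 + 14%:R * a1 * a4 - 16%:R * a2 * a3;
      6%:R * a1 * a5 + 6%:R * a2 * a4 - 12%:R * a3 ^+ 2;
      6%:R * a2 * a5 - 6%:R * a3 * a4;
      2%:R * a3 * a5 - 2%:R * a4 ^+ 2].
Proof. rewrite /cov_H (transvectant_form char0) //; eval_form. Qed.

Lemma cov_tE : cov_t F = form 9
  [:: a0 ^+ 2 * a3 + 2%:R * a1 ^+ 3 - 3%:R * a0 * a1 * a2;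
      2%:R * a0 ^+ 2 * a4 + a0 * a1 * a3 + 9%:R * a1 ^+ 2 * a2
        - 12%:R * a0 * a2 ^+ 2;
      a0 ^+ 2 * a5 + 11%:R * a0 * a1 * a4 + 16%:R * a1 ^+ 2 * a3
        + 6%:R * a1 * a2 ^+ 2 - 34%:R * a0 * a2 * a3;
      7%:R * a0 * a1 * a5 + 29%:R * a1 ^+ 2 * a4 + 8%:R * a2 ^+ 3
        - 8%:R * a0 * a2 * a4 - 34%:R * a0 * a3 ^+ 2
        - 2%:R * a1 * a2 * a3;
      5%:R * a0 * a2 * a5 + 16%:R * a1 ^+ 2 * a5 + 47%:R * a1 * a2 * a4
        + 16%:R * a2 ^+ 2 * a3 - 40%:R * a0 * a3 * a4
        - 44%:R * a1 * a3 ^+ 2;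
      40%:R * a1 * a2 * a5 + 44%:R * a2 ^+ 2 * a4 - 5%:R * a0 * a3 * a5
        - 47%:R * a1 * a3 * a4 - 16%:R * a2 * a3 ^+ 2
        - 16%:R * a0 * a4 ^+ 2;
      8%:R * a1 * a3 * a5 + 34%:R * a2 ^+ 2 * a5 + 2%:R * a2 * a3 * a4
        - 29%:R * a1 * a4 ^+ 2 - 8%:R * a3 ^+ 3 - 7%:R * a0 * a4 * a5;
      34%:R * a2 * a3 * a5 - 16%:R * a2 * a4 ^+ 2 - 6%:R * a3 ^+ 2 * a4
        - 11%:R * a1 * a4 * a5 - a0 * a5 ^+ 2;
      12%:R * a3 ^+ 2 * a5 - 9%:R * a3 * a4 ^+ 2 - a2 * a4 * a5
        - 2%:R * a1 * a5 ^+ 2;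
      3%:R * a3 * a4 * a5 - 2%:R * a4 ^+ 3 - a2 * a5 ^+ 2].
Proof. rewrite /cov_t cov_HE (transvectant_form char0) //; eval_form. Qed.

Lemma cov_c35E : cov_c35 F = form 5
  [:: 5%:R * a0 * a1 * a4 + 6%:R * a1 * a2 ^+ 2 - 8%:R * a1 ^+ 2 * a3
        - a0 ^+ 2 * a5 - 2%:R * a0 * a2 * a3;
      16%:R * a0 * a2 * a4 + 24%:R * a2 ^+ 3 + 9%:R * a1 ^+ 2 * a4
        - 38%:R * a1 * a2 * a3 - 5%:R * a0 * a1 * a5
        - 6%:R * a0 * a3 ^+ 2;
      12%:R * a0 * a3 * a4 + 32%:R * a2 ^+ 2 * a3 + 38%:R * a1 * a2 * a4
        - 72%:R * a1 * a3 ^+ 2 - 2%:R * a0 * a2 * a5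
        - 8%:R * a1 ^+ 2 * a5;
      8%:R * a0 * a4 ^+ 2 + 72%:R * a2 ^+ 2 * a4 + 2%:R * a0 * a3 * a5
        - 38%:R * a1 * a3 * a4 - 32%:R * a2 * a3 ^+ 2
        - 12%:R * a1 * a2 * a5;
      5%:R * a0 * a4 * a5 + 6%:R * a2 ^+ 2 * a5 + 38%:R * a2 * a3 * a4
        - 16%:R * a1 * a3 * a5 - 9%:R * a1 * a4 ^+ 2 - 24%:R * a3 ^+ 3;
      a0 * a5 ^+ 2 + 2%:R * a2 * a3 * a5 + 8%:R * a2 * a4 ^+ 2
        - 5%:R * a1 * a4 * a5 - 6%:R * a3 ^+ 2 * a4].
Proof. rewrite /cov_c35 cov_iE (transvectant_form char0) //; eval_form. Qed.

Lemma cov_c33E : cov_c33 F = form 3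
  [:: 6%:R * a2 ^+ 3 + 6%:R * a1 ^+ 2 * a4 + 6%:R * a0 * a3 ^+ 2
        - 6%:R * a0 * a2 * a4 - 12%:R * a1 * a2 * a3;
      6%:R * a0 * a3 * a4 + 6%:R * a2 ^+ 2 * a3 + 6%:R * a1 ^+ 2 * a5
        - 6%:R * a1 * a3 ^+ 2 - 6%:R * a0 * a2 * a5
        - 6%:R * a1 * a2 * a4;
      6%:R * a0 * a4 ^+ 2 + 6%:R * a2 * a3 ^+ 2 + 6%:R * a1 * a2 * a5
        - 6%:R * a1 * a3 * a4 - 6%:R * a2 ^+ 2 * a4
        - 6%:R * a0 * a3 * a5;
      6%:R * a2 ^+ 2 * a5 + 6%:R * a1 * a4 ^+ 2 + 6%:R * a3 ^+ 3
        - 6%:R * a1 * a3 * a5 - 12%:R * a2 * a3 * a4].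
Proof. rewrite /cov_c33 cov_iE (transvectant_form char0) //; eval_form. Qed.

End Covariants.

(** * Products of the cubic covariants at x^3 + y^3 *)

Lemma mul_G_hE : G * cov_h G = form 5 [:: 0; 2%:R; 0; 0; 2%:R; 0].
Proof. by rewrite cov_hE form_muls //; eval_form. Qed.

Lemma mul_h_qE : cov_h G * cov_q G = form 5 [:: 0; 2%:R; 0; 0; - 2%:R; 0].
Proof. by rewrite cov_hE cov_qE form_muls //; eval_form. Qed.

Lemma exp_G2E : G ^+ 2 = form 6 [:: 1; 0; 0; 2%:R; 0; 0; 1].
Proof. by rewrite expr2 form_muls //; eval_form. Qed.

Lemma mul_G_qE : G * cov_q G = form 6 [:: 1; 0; 0; 0; 0; 0; - 1].
Proof. by rewrite cov_qE form_muls //; eval_form. Qed.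

Lemma exp_q2E : cov_q G ^+ 2 = form 6 [:: 1; 0; 0; - 2%:R; 0; 0; 1].
Proof. by rewrite expr2 cov_qE form_muls //; eval_form. Qed.

Lemma exp_G3E : G ^+ 3 = form 9 [:: 1; 0; 0; 3%:R; 0; 0; 3%:R; 0; 0; 1].
Proof. by rewrite exprS exp_G2E form_muls //; eval_form. Qed.

Lemma mul_G2_qE : G ^+ 2 * cov_q G = form 9
  [:: 1; 0; 0; 1; 0; 0; - 1; 0; 0; - 1].
Proof. by rewrite exp_G2E cov_qE form_muls //; eval_form. Qed.

Lemma exp_G4E : G ^+ 4 = form 12
  [:: 1; 0; 0; 4%:R; 0; 0; 6%:R; 0; 0; 4%:R; 0; 0; 1].
Proof. by rewrite exprS exp_G3E form_muls //; eval_form. Qed.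

Lemma exp_G5E : G ^+ 5 = form 15
  [:: 1; 0; 0; 5%:R; 0; 0; 10%:R; 0; 0; 10%:R; 0; 0; 5%:R; 0; 0; 1].
Proof. by rewrite exprS exp_G4E form_muls //; eval_form. Qed.

Lemma mul_G4_qE : G ^+ 4 * cov_q G = form 15
  [:: 1; 0; 0; 3%:R; 0; 0; 2%:R; 0; 0; - 2%:R; 0; 0; - 3%:R; 0; 0; - 1].
Proof. by rewrite exp_G4E cov_qE form_muls //; eval_form. Qed.

(** * Joint invariants and numerators in the coordinates of S_3 *)

Section Invariants.
Variables e s u1 u2 v1 v2 : k.

Local Notation F := (quintic e s u1 u2 v1 v2).
Local Notation uu := (u1 * u2).
Local Notation vv := (v1 * v2).
Local Notation uv := (u1 * v2 + u2 * v1).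
Local Notation w := (u1 * v2 - u2 * v1).
Local Notation c30 := (u1 ^+ 3 + u2 ^+ 3).
Local Notation c21 := (u1 ^+ 2 * v1 + u2 ^+ 2 * v2).
Local Notation c12 := (u1 * v1 ^+ 2 + u2 * v2 ^+ 2).
Local Notation c03 := (v1 ^+ 3 + v2 ^+ 3).
Local Notation d30 := (u1 ^+ 3 - u2 ^+ 3).
Local Notation d21 := (u1 ^+ 2 * v1 - u2 ^+ 2 * v2).
Local Notation d12 := (u1 * v1 ^+ 2 - u2 * v2 ^+ 2).
Local Notation d03 := (v1 ^+ 3 - v2 ^+ 3).

Ltac eval_pairing :=
  rewrite (full_transvectant_form _ _ _ char0); eval_coefs; char0_field.

Lemma quintic_cubeE (l := [:: - u2; 5%:R * (e + s); 10%:R * v1; 10%:R * - v2;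
    5%:R * (e - s); u1]) :
  F ^+ 3 = form 15 (muls (muls l l) l).
Proof. by rewrite /quintic exprSr expr2 !form_muls. Qed.

Lemma inv_DE : inv_D G = - 2%:R.
Proof. by rewrite /inv_D cov_hE; eval_pairing. Qed.

Lemma inv_AE : inv_A F G = - 4%:R * s.
Proof. rewrite /inv_A /quintic mul_G_hE; eval_pairing. Qed.

Lemma inv_LE : inv_L F G = 4%:R * e.
Proof. rewrite /inv_L /quintic mul_h_qE; eval_pairing. Qed.

Lemma inv_B1E : inv_B1 F G =
  4%:R * vv + 2%:R * uu + 6%:R * e ^+ 2 - 6%:R * s ^+ 2.
Proof. rewrite /inv_B1 /quintic cov_iE cov_hE; eval_pairing. Qed.

Lemma inv_B2E : inv_B2 F G =
  (uu - 10%:R * uv - 8%:R * vv - 27%:R * e ^+ 2 - 13%:R * s ^+ 2) / 5%:R.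
Proof. rewrite /inv_B2 /quintic cov_HE exp_G2E; eval_pairing. Qed.

Lemma inv_ME : inv_M F G = 8%:R * s * e - 2%:R * w.
Proof. rewrite /inv_M /quintic cov_HE mul_G_qE; eval_pairing. Qed.

Lemma inv_NE : inv_N F G =
  (8%:R * vv - 10%:R * uv - uu - 13%:R * e ^+ 2 - 27%:R * s ^+ 2) / 5%:R.
Proof. rewrite /inv_N /quintic cov_HE exp_q2E; eval_pairing. Qed.

Lemma inv_RE : inv_R F G =
  6%:R * c03 + 24%:R * s * vv + 12%:R * s * e ^+ 2 - 6%:R * c12 - 6%:R * e * w
    - 6%:R * s * uv - 12%:R * s ^+ 3.
Proof. rewrite /inv_R /quintic cov_c33E; eval_pairing. Qed.

Lemma inv_S1E : inv_S1 F G =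
  12%:R * s ^+ 2 * e - 6%:R * d03 - 6%:R * d12 - 6%:R * e * uv - 24%:R * e * vv
    - 12%:R * e ^+ 3 - 6%:R * s * w.
Proof. rewrite /inv_S1 /quintic cov_c33E cov_qE; eval_pairing. Qed.

Lemma inv_S2E : inv_S2 F G =
  (12%:R * d12 + 32%:R * e * uv + 32%:R * s * w + 36%:R * s ^+ 2 * e
    - 48%:R * d03 - 152%:R * e * vv - 20%:R * e * uu - 36%:R * e ^+ 3) / 5%:R.
Proof. rewrite /inv_S2 /quintic cov_c35E mul_G_hE; eval_pairing. Qed.

Lemma inv_S3E : inv_S3 F G =
  (17%:R * d12 + 14%:R * d21 + 38%:R * e * uv + 7%:R * e * uu + 27%:R * e ^+ 3
    + 197%:R * s ^+ 2 * e - 4%:R * d03 - 2%:R * e * vv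
    - 46%:R * s * w) / 14%:R.
Proof. rewrite /inv_S3 /quintic cov_tE exp_G3E; eval_pairing. Qed.

Lemma inv_T1E : inv_T1 F G =
  (48%:R * c03 + 12%:R * c12 + 32%:R * e * w + 32%:R * s * uv + 152%:R * s * vv
    + 20%:R * s * uu + 36%:R * s * e ^+ 2 - 36%:R * s ^+ 3) / 5%:R.
Proof. rewrite /inv_T1 /quintic cov_c35E mul_h_qE; eval_pairing. Qed.

Lemma inv_T2E : inv_T2 F G =
  (4%:R * c03 + 17%:R * c12 + 42%:R * c21 + 122%:R * e * w + 2%:R * s * vv
    - 130%:R * s * uv - 7%:R * s * uu - 475%:R * s * e ^+ 2
    - 197%:R * s ^+ 3) / 42%:R.
Proof. rewrite /inv_T2 /quintic cov_tE mul_G2_qE; eval_pairing. Qed.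

Lemma inv_T3E : inv_T3 F G =
  (2000%:R * c03 + 330%:R * c21 + 3900%:R * s * uv - 600%:R * c12
    - 1001%:R * c30 - 2700%:R * e * w - 12000%:R * s * vv - 120%:R * s * uu
    - 6750%:R * s * e ^+ 2 - 4250%:R * s ^+ 3) / 1001%:R.
Proof. rewrite /inv_T3 quintic_cubeE exp_G5E; eval_pairing. Qed.

Lemma inv_WE : inv_W F G =
  (198%:R * d21 + 2400%:R * e * vv + 24%:R * e * uu + 1350%:R * e ^+ 3
    + 2100%:R * s * w + 5250%:R * s ^+ 2 * e - 400%:R * d03 - 120%:R * d12
    - 1001%:R * d30 - 1860%:R * e * uv) / 1001%:R.
Proof. rewrite /inv_W quintic_cubeE mul_G4_qE; eval_pairing. Qed.

Lemma P1E : P1 F G = - 2800%:R * s.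
Proof. rewrite /P1 inv_AE; char0_field. Qed.

(** With p = u + 98 v and r = 149 u + 490 v, the right-hand side is -20000 p1 p2. Likewise [P4] is
    400 (p1 r2 + p2 r1) and [Q_p02] is -(16/3) r1 r2, while [P3], [P5], [Q_p12] and [Q_p03] are
    multiples of the sums over both indices of p^3, p^2 r, p r^2 and r^3. In [P6], [Q_w21], [Q_w12]
    and [Q_w03] the same cubics occur as differences, times e. *)
Lemma P2E : P2 F G = - (1960000%:R * uv + 192080000%:R * vv + 20000%:R * uu).
Proof.
rewrite /P2 inv_DE inv_AE inv_LE inv_B1E inv_B2E inv_NE; char0_field.
Qed.

Lemma P3E : P3 F G =
  - (6594932344000000%:R * c03 + 201885684000000%:R * c12
    + 2060058000000%:R * c21 + 7007000000%:R * c30).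
Proof.
rewrite /P3 inv_DE inv_AE inv_LE inv_B1E inv_B2E inv_ME inv_NE inv_RE inv_T1E
  inv_T2E inv_T3E; char0_field.
Qed.

Lemma P4E : P4 F G = 6036800%:R * uv + 38416000%:R * vv + 119200%:R * uu.
Proof.
rewrite /P4 inv_DE inv_AE inv_LE inv_B1E inv_B2E inv_NE; char0_field.
Qed.

Lemma P5E : P5 F G =
  1318986468800000%:R * c03 + 427997650080000%:R * c12 + 8322634320000%:R * c21
    + 41761720000%:R * c30.
Proof.
rewrite /P5 inv_DE inv_AE inv_LE inv_B1E inv_B2E inv_ME inv_NE inv_RE inv_T1E
  inv_T2E inv_T3E; char0_field.
Qed.

Lemma P6E : P6 F G =
  - (131898646880000000%:R * e * d03 + 4037713680000000%:R * e * d12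
    + 41201160000000%:R * e * d21 + 140140000000%:R * e * d30).
Proof.
rewrite /P6 inv_DE inv_AE inv_LE inv_B1E inv_B2E inv_ME inv_NE inv_S1E inv_S2E
  inv_S3E inv_WE; char0_field.
Qed.

Lemma Q_e2E : Q_e2 F G = 4233600%:R * e ^+ 2.
Proof. rewrite /Q_e2 inv_LE; char0_field. Qed.

Lemma Q_p02E : Q_p02 F G =
  - (1168160%:R * uv + 3841600%:R * vv + 355216%:R * uu) / 3%:R.
Proof.
rewrite /Q_p02 inv_DE inv_AE inv_LE inv_B1E inv_B2E inv_NE; char0_field.
Qed.

Lemma Q_p12E : Q_p12 F G =
  - (9411920000%:R * c03 + 5820024000%:R * c12 + 928687200%:R * c21
    + 8880400%:R * c30) / 27%:R.
Proof.
rewrite /Q_p12; apply: (@eq_div_mul _ 27%:R (28%:R * 1001%:R)).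
- by ring.
- exact: natS_neq0.
- by rewrite ?mulf_neq0 ?natS_neq0.
rewrite inv_DE inv_AE inv_LE inv_B1E inv_B2E inv_ME inv_NE inv_RE inv_T1E
  inv_T2E inv_T3E; char0_field.
Qed.

Lemma Q_p03E : Q_p03 F G =
  (1882384000%:R * c03 + 1717195200%:R * c12 + 522167520%:R * c21
    + 52927184%:R * c30) / 9%:R.
Proof.
rewrite /Q_p03; apply: (@eq_div_mul _ 9%:R (28%:R * 1001%:R)).
- by ring.
- exact: natS_neq0.
- by rewrite ?mulf_neq0 ?natS_neq0.
rewrite inv_DE inv_AE inv_LE inv_B1E inv_B2E inv_ME inv_NE inv_RE inv_T1E
  inv_T2E inv_T3E; char0_field.
Qed.

Lemma Q_w2E : Q_w2 F G = 790272000%:R * e * w.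
Proof. rewrite /Q_w2 inv_DE inv_AE inv_LE inv_ME; char0_field. Qed.

Lemma Q_w21E : Q_w21 F G =
  (26353376000000%:R * e * d03 + 8551401600000%:R * e * d12
    + 166286400000%:R * e * d21 + 834400000%:R * e * d30) / 9%:R.
Proof.
rewrite /Q_w21; apply: (@eq_div_mul _ 9%:R (1001%:R)).
- by ring.
- exact: natS_neq0.
- by rewrite ?mulf_neq0 ?natS_neq0.
rewrite inv_DE inv_AE inv_LE inv_B1E inv_B2E inv_ME inv_NE inv_S1E inv_S2E
  inv_S3E inv_WE; char0_field.
Qed.

Lemma Q_w12E : Q_w12 F G =
  - (5270675200000%:R * e * d03 + 3259213440000%:R * e * d12
    + 520064832000%:R * e * d21 + 4973024000%:R * e * d30) / 3%:R.
Proof.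
rewrite /Q_w12; apply: (@eq_div_mul _ 3%:R (1001%:R)).
- by ring.
- exact: natS_neq0.
- by rewrite ?mulf_neq0 ?natS_neq0.
rewrite inv_DE inv_AE inv_LE inv_B1E inv_B2E inv_ME inv_NE inv_S1E inv_S2E
  inv_S3E inv_WE; char0_field.
Qed.

Lemma Q_w03E : Q_w03 F G =
  1054135040000%:R * e * d03 + 961629312000%:R * e * d12
    + 292413811200%:R * e * d21 + 29639223040%:R * e * d30.
Proof.
rewrite /Q_w03 inv_DE inv_AE inv_LE inv_B1E inv_B2E inv_ME inv_NE inv_S1E inv_S2E
  inv_S3E inv_WE; char0_field.
Qed.

(* The relations below come from inverting the linear systems formed by the
   preceding expressions of the P_i and Q_g. *)
Lemma s_values : 2%:R ^+ 4 * 5%:R ^+ 2 * 7%:R * s = - P1 F G.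
Proof. by rewrite P1E; char0_field. Qed.

Lemma e2_values :
  2%:R ^+ 7 * 3%:R ^+ 3 * 5%:R ^+ 2 * 7%:R ^+ 2 * e ^+ 2 =
  Q_e2 F G.
Proof. by rewrite Q_e2E; char0_field. Qed.

Lemma ew_values :
  2%:R ^+ 11 * 3%:R ^+ 2 * 5%:R ^+ 3 * 7%:R ^+ 3 * (e * w) =
  Q_w2 F G.
Proof. by rewrite Q_w2E; char0_field. Qed.

(** Since u = (r - 5 p) / 144 and v = (149 p - r) / 14112, expanding u1 u2 in p and r gives these
    coefficients. The powers of 149 in the later relations come from v in the same way. *)
Lemma uu_values :
  2%:R ^+ 13 * 3%:R ^+ 4 * 5%:R ^+ 2 * uu =
  - P2 F G - 10%:R * P4 F G - 150%:R * Q_p02 F G.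
Proof. by rewrite P2E P4E Q_p02E; char0_field. Qed.

Lemma uv_values :
  2%:R ^+ 13 * 3%:R ^+ 4 * 5%:R ^+ 3 * 7%:R ^+ 2 * uv =
  149%:R * P2 F G + 770%:R * P4 F G + 750%:R * Q_p02 F G.
Proof. by rewrite P2E P4E Q_p02E; char0_field. Qed.

Lemma vv_values :
  2%:R ^+ 15 * 3%:R ^+ 4 * 5%:R ^+ 4 * 7%:R ^+ 4 * vv =
  - 22201%:R * P2 F G - 7450%:R * P4 F G - 3750%:R * Q_p02 F G.
Proof. by rewrite P2E P4E Q_p02E; char0_field. Qed.

Lemma c30_values :
  2%:R ^+ 18 * 3%:R ^+ 6 * 5%:R ^+ 3 * 7%:R ^+ 2 * 11%:R * 13%:R * c30 =
  P3 F G + 15%:R * P5 F G + 56756700%:R * Q_p12 F G + 31531500%:R * Q_p03 F G.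
Proof. by rewrite P3E P5E Q_p12E Q_p03E; char0_field. Qed.

Lemma c21_values :
  2%:R ^+ 19 * 3%:R ^+ 6 * 5%:R ^+ 4 * 7%:R ^+ 4 * 11%:R * 13%:R * c21 =
  - 149%:R * P3 F G - 1515%:R * P5 F G - 3008105100%:R * Q_p12 F G
    - 157657500%:R * Q_p03 F G.
Proof. by rewrite P3E P5E Q_p12E Q_p03E; char0_field. Qed.

Lemma c12_values :
  2%:R ^+ 20 * 3%:R ^+ 6 * 5%:R ^+ 5 * 7%:R ^+ 6 * 11%:R * 13%:R * c12 =
  22201%:R * P3 F G + 118455%:R * P5 F G + 28662133500%:R * Q_p12 F G
    + 788287500%:R * Q_p03 F G.
Proof. by rewrite P3E P5E Q_p12E Q_p03E; char0_field. Qed.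

Lemma c03_values :
  2%:R ^+ 21 * 3%:R ^+ 6 * 5%:R ^+ 6 * 7%:R ^+ 8 * 11%:R * 13%:R * c03 =
  - 3307949%:R * P3 F G - 1665075%:R * P5 F G - 211418707500%:R * Q_p12 F G
    - 3941437500%:R * Q_p03 F G.
Proof. by rewrite P3E P5E Q_p12E Q_p03E; char0_field. Qed.

Lemma ed30_values :
  2%:R ^+ 20 * 3%:R ^+ 6 * 5%:R ^+ 4 * 7%:R ^+ 2 * 11%:R * 13%:R * (e * d30) =
  P6 F G + 135135%:R * Q_w21 F G + 225225%:R * Q_w12 F G
    + 125125%:R * Q_w03 F G.
Proof. by rewrite P6E Q_w21E Q_w12E Q_w03E; char0_field. Qed.

Lemma ed03_values :
  2%:R ^+ 23 * 3%:R ^+ 6 * 5%:R ^+ 7 * 7%:R ^+ 8 * 11%:R * 13%:R * (e * d03) =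
  - 3307949%:R * P6 F G - 15000660675%:R * Q_w21 F G - 838963125%:R * Q_w12 F G
    - 15640625%:R * Q_w03 F G.
Proof. by rewrite P6E Q_w21E Q_w12E Q_w03E; char0_field. Qed.

End Invariants.
End Values.

(** * Separation of orbits of S_3 *)

Section Separation.
Variable k : fieldType.

Definition rotated (z u1 u2 v1 v2 u1' u2' v1' v2' : k) :=
  [/\ u1' = z * u1, u2' = z ^+ 2 * u2, v1' = z * v1 & v2' = z ^+ 2 * v2].

Definition std2_orbit (u1 u2 v1 v2 u1' u2' v1' v2' : k) :=
  exists2 z, z ^+ 3 = 1 &
    rotated z u1 u2 v1 v2 u1' u2' v1' v2' \/
    rotated z u2 u1 v2 v1 u1' u2' v1' v2'.

Lemma std2_orbit_swap u1 u2 v1 v2 u1' u2' v1' v2' :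
  std2_orbit u1 u2 v1 v2 u1' u2' v1' v2' ->
  std2_orbit u2 u1 v2 v1 u1' u2' v1' v2'.
Proof. by case=> z z3 [] h; exists z => //; [right|left]. Qed.

(** Exchanging the indices on both sides conjugates by a reflection, which turns the rotation by z
    into the one by its inverse z^2. *)
Lemma std2_orbit_swap2 u1 u2 v1 v2 u1' u2' v1' v2' :
  std2_orbit u2 u1 v2 v1 u2' u1' v2' v1' ->
  std2_orbit u1 u2 v1 v2 u1' u2' v1' v2'.
Proof.
case=> z z3 h; have z4 x : (z ^+ 2) ^+ 2 * x = z * x.
  by rewrite -exprM exprS z3 mulr1.
exists (z ^+ 2); first by rewrite -exprM mulnC exprM z3 expr1n.
by case: h => [] [-> -> -> ->]; [left|right]; split; rewrite ?z4.
Qed.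

Lemma cube_root_sq (z : k) : z ^+ 3 = 1 -> z ^+ 2 = z^-1.
Proof.
move=> z3; have z0 : z != 0.
  by apply: contra_eq_neq z3 => ->; rewrite expr0n eq_sym oner_neq0.
by apply: (mulfI z0); rewrite -exprS z3 divff.
Qed.

Lemma cube_root_mul (z x y : k) : z ^+ 3 = 1 ->
  (z * x) * (z ^+ 2 * y) = x * y.
Proof. by move=> z3; rewrite mulrACA -exprS z3 mul1r. Qed.

Lemma cube_root_mul' (z x y : k) : z ^+ 3 = 1 ->
  (z ^+ 2 * x) * (z * y) = x * y.
Proof. by move=> z3; rewrite mulrACA -exprSr z3 mul1r. Qed.

(* Rotating by z = u1'/u1 reduces to u' = u. Then the equations for v' - v are
   linear, and nonsingular unless u1^3 = u2^3, when a reflection fixes u. *)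
Lemma std2_orbit_cube u1 u2 v1 v2 u1' u2' v1' v2' :
    u1 != 0 -> u1' ^+ 3 = u1 ^+ 3 ->
    u1' * u2' = u1 * u2 -> u1' * v2' + u2' * v1' = u1 * v2 + u2 * v1 ->
    u1' ^+ 2 * v1' + u2' ^+ 2 * v2' = u1 ^+ 2 * v1 + u2 ^+ 2 * v2 ->
    v1' * v2' = v1 * v2 ->
  std2_orbit u1 u2 v1 v2 u1' u2' v1' v2'.
Proof.
move=> u10 cu Huu Huv Hc21 Hvv.
pose z := u1' / u1.
have z3 : z ^+ 3 = 1 by rewrite /z exprMn exprVn cu divff // expf_neq0.
have u1'E : u1' = z * u1 by rewrite /z divfK.
have z0 : z != 0.
  by apply: contra_eq_neq z3 => ->; rewrite expr0n eq_sym oner_neq0.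
have z2 := cube_root_sq z3.
have u2'E : u2' = z ^+ 2 * u2.
  apply: (mulfI u10); apply: (mulfI z0).
  by rewrite mulrA -u1'E Huu z2 mulrCA mulVKf.
(* (y1, y2) is v' rotated back by z^-1 = z^2, to be compared with v while u stays put. *)
pose y1 := z ^+ 2 * v1'; pose y2 := z * v2'.
have v1'E : v1' = z * y1 by rewrite /y1 mulrA -exprS z3 mul1r.
have v2'E : v2' = z ^+ 2 * y2 by rewrite /y2 mulrA -exprSr z3 mul1r.
have Ev : y1 * y2 = v1 * v2.
  by rewrite -Hvv v1'E v2'E cube_root_mul.
have Euv : u1 * (y2 - v2) = - (u2 * (y1 - v1)).
  have : u1 * y2 + u2 * y1 = u1 * v2 + u2 * v1.
    by rewrite -Huv u1'E u2'E v1'E v2'E cube_root_mul // cube_root_mul'.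
  by move=> h; rewrite !mulrBr -(addrK (u2 * y1) (u1 * y2)) h; ring.
have Ec : u1 ^+ 2 * (y1 - v1) + u2 ^+ 2 * (y2 - v2) = 0.
  have : u1 ^+ 2 * y1 + u2 ^+ 2 * y2 = u1 ^+ 2 * v1 + u2 ^+ 2 * v2.
    rewrite -Hc21 u1'E u2'E v1'E v2'E.
    have -> : (z * u1) ^+ 2 * (z * y1) = z ^+ 3 * (u1 ^+ 2 * y1) by ring.
    have -> : (z ^+ 2 * u2) ^+ 2 * (z ^+ 2 * y2) =
      (z ^+ 3) ^+ 2 * (u2 ^+ 2 * y2) by ring.
    by rewrite z3 expr1n !mul1r.
  by move=> h; rewrite !mulrBr -(addrK (u2 ^+ 2 * y2) (u1 ^+ 2 * y1)) h; ring.
have : (y1 - v1) * (u1 ^+ 3 - u2 ^+ 3) = 0.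
  have -> : (y1 - v1) * (u1 ^+ 3 - u2 ^+ 3) =
     u1 * (u1 ^+ 2 * (y1 - v1)) - u2 ^+ 2 * (u2 * (y1 - v1)) by ring.
  rewrite -[u2 * _]opprK -Euv mulrN opprK [u2 ^+ 2 * _]mulrCA.
  by rewrite -mulrDr Ec mulr0.
move/eqP; rewrite mulf_eq0 => /orP[/eqP p0|].
  exists z => //; left; split => //; first by rewrite v1'E -[v1]add0r -p0 subrK.
  move: Euv; rewrite p0 mulr0 oppr0 => /eqP; rewrite mulf_eq0 (negPf u10) /=.
  by rewrite subr_eq0 v2'E => /eqP ->.
rewrite subr_eq0 => /eqP cu12.
pose t := u2 / u1.
have t3 : t ^+ 3 = 1 by rewrite /t exprMn exprVn -cu12 divff // expf_neq0.
have u2E : u2 = t * u1 by rewrite /t divfK.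
have y2E : y2 = v2 - t * (y1 - v1).
  apply: (mulfI u10).
  have -> : u1 * (v2 - t * (y1 - v1)) = u1 * v2 - t * u1 * (y1 - v1) by ring.
  by rewrite -u2E -Euv mulrBr addrC subrK.
(* After elimination of [y2], the equation y1 y2 = v1 v2 factors. The second root y1 = v2 / t is the
   image of v under the reflection (a1, a2) -> (a2 / t, t a1), which fixes u because u2 = t u1. *)
have : (y1 - v1) * (v2 - t * y1) = 0.
  have -> : (y1 - v1) * (v2 - t * y1) = y1 * y2 - v1 * v2 by rewrite y2E; ring.
  by rewrite Ev subrr.
move/eqP; rewrite mulf_eq0 !subr_eq0 => /orP[|] /eqP yE.
  exists z => //; left; split => //; first by rewrite v1'E yE.
  by rewrite v2'E y2E yE subrr mulr0 subr0.
have zt2 : (z * t ^+ 2) ^+ 2 = z ^+ 2 * t.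
  have -> : (z * t ^+ 2) ^+ 2 = z ^+ 2 * t * t ^+ 3 by ring.
  by rewrite t3 mulr1.
have tt : t ^+ 2 * t = 1 by rewrite -exprSr.
(* That reflection followed by the rotation by z; here t^2 is the inverse of t. *)
exists (z * t ^+ 2).
  by rewrite exprMn z3 mul1r -exprM mulnC exprM t3 expr1n.
right; split; rewrite ?zt2.
- by rewrite u2E -mulrA [t ^+ 2 * _]mulrA tt mul1r.
- by rewrite u2'E u2E mulrA.
- by rewrite v1'E -mulrA yE [t ^+ 2 * _]mulrA tt mul1r.
- by rewrite v2'E -mulrA y2E yE; congr (_ * _); ring.
Qed.

Lemma std2_orbit_nonzero u1 u2 v1 v2 u1' u2' v1' v2' :
    (u1 != 0) || (u2 != 0) ->
    u1' * u2' = u1 * u2 -> u1' ^+ 3 + u2' ^+ 3 = u1 ^+ 3 + u2 ^+ 3 ->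
    u1' * v2' + u2' * v1' = u1 * v2 + u2 * v1 ->
    u1' ^+ 2 * v1' + u2' ^+ 2 * v2' = u1 ^+ 2 * v1 + u2 ^+ 2 * v2 ->
    v1' * v2' = v1 * v2 ->
  std2_orbit u1 u2 v1 v2 u1' u2' v1' v2'.
Proof.
move=> u0 Huu Hc30 Huv Hc21 Hvv.
wlog cu : u1 u2 v1 v2 u0 Huu Hc30 Huv Hc21 Hvv / u1' ^+ 3 = u1 ^+ 3.
  (* The sum and the product of the two cubes are known, so u1'^3 is a root of the quadratic whose
     roots are u1^3 and u2^3. In the second case the indices of the unprimed vectors are
     exchanged. *)
  move=> IH; have : (u1' ^+ 3 - u1 ^+ 3) * (u1' ^+ 3 - u2 ^+ 3) = 0.
    have -> : (u1' ^+ 3 - u1 ^+ 3) * (u1' ^+ 3 - u2 ^+ 3) =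
      u1' ^+ 3 * u1' ^+ 3 - (u1 ^+ 3 + u2 ^+ 3) * u1' ^+ 3 + (u1 * u2) ^+ 3.
      by ring.
    by rewrite -Hc30 -Huu; ring.
  move/eqP; rewrite mulf_eq0 !subr_eq0 => /orP[|] /eqP cu; first exact: IH.
  apply: std2_orbit_swap; apply: IH => //; first by rewrite orbC.
  - by rewrite [RHS]mulrC.
  - by rewrite [RHS]addrC.
  - by rewrite [RHS]addrC.
  - by rewrite [RHS]addrC.
  - by rewrite [RHS]mulrC.
(* If u1 = 0 then u2 is nonzero and can serve as divisor, after exchanging indices on both sides. *)
have [u10|u10] := eqVneq u1 0; last exact: std2_orbit_cube.
have cu2 : u2' ^+ 3 = u2 ^+ 3.
  by apply: (addrI (u1' ^+ 3)); rewrite Hc30 cu.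
apply: std2_orbit_swap2; apply: std2_orbit_cube => //.
- by move: u0; rewrite u10 eqxx.
- by rewrite mulrC Huu mulrC.
- by rewrite addrC Huv addrC.
- by rewrite addrC Hc21 addrC.
- by rewrite mulrC Hvv mulrC.
Qed.

Lemma std2_orbit_swap_uv u1 u2 v1 v2 u1' u2' v1' v2' :
  std2_orbit v1 v2 u1 u2 v1' v2' u1' u2' ->
  std2_orbit u1 u2 v1 v2 u1' u2' v1' v2'.
Proof. by case=> z z3 [] [] *; exists z => //; [left|right]; split. Qed.

Lemma std2_separation u1 u2 v1 v2 u1' u2' v1' v2' :
    u1' * u2' = u1 * u2 -> u1' * v2' + u2' * v1' = u1 * v2 + u2 * v1 ->
    v1' * v2' = v1 * v2 ->
    u1' ^+ 3 + u2' ^+ 3 = u1 ^+ 3 + u2 ^+ 3 ->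
    u1' ^+ 2 * v1' + u2' ^+ 2 * v2' = u1 ^+ 2 * v1 + u2 ^+ 2 * v2 ->
    u1' * v1' ^+ 2 + u2' * v2' ^+ 2 = u1 * v1 ^+ 2 + u2 * v2 ^+ 2 ->
    v1' ^+ 3 + v2' ^+ 3 = v1 ^+ 3 + v2 ^+ 3 ->
  std2_orbit u1 u2 v1 v2 u1' u2' v1' v2'.
Proof.
have zero a b : a * b = 0 -> a ^+ 3 + b ^+ 3 = 0 -> a = 0 /\ b = 0 :> k.
  move/eqP; rewrite mulf_eq0 => /orP[] /eqP ->; rewrite expr0n ?add0r ?addr0;
  by move/eqP; rewrite expf_eq0 => /eqP ->.
move=> Huu Huv Hvv Hc30 Hc21 Hc12 Hc03.
have [u0|] := boolP ((u1 != 0) || (u2 != 0)); first exact: std2_orbit_nonzero.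
have [v0 _|] := boolP ((v1 != 0) || (v2 != 0)).
  apply/std2_orbit_swap_uv/std2_orbit_nonzero => //.
  - by apply: (etrans _ (etrans Huv _)); ring.
  - by apply: (etrans _ (etrans Hc12 _)); ring.
rewrite !negb_or !negbK => /andP[/eqP v10 /eqP v20] /andP[/eqP u10 /eqP u20].
move: Huu Hvv Hc30 Hc03.
rewrite u10 u20 v10 v20 expr0n mulr0 addr0 => h1 h2 h3 h4.
have [-> ->] := zero _ _ h1 h3; have [-> ->] := zero _ _ h2 h4.
by exists 1; rewrite ?expr1n //; left; split; rewrite ?mulr0.
Qed.

(** The three functions change sign under every reflection. Conversely, where they all vanish, u and
    v are fixed by a common reflection (a1, a2) -> (a2 / t, t a1). *)
Lemma std2_reflection u1 u2 v1 v2 :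
  u1 * v2 - u2 * v1 = 0 -> u1 ^+ 3 - u2 ^+ 3 = 0 -> v1 ^+ 3 - v2 ^+ 3 = 0 ->
  exists2 t : k, t ^+ 3 = 1 & u2 = t * u1 /\ v2 = t * v1.
Proof.
move=> /subr0_eq w0 /subr0_eq du /subr0_eq dv.
have [u10|u10] := eqVneq u1 0; last first.
  exists (u2 / u1); first by rewrite exprMn exprVn -du divff // expf_neq0.
  rewrite divfK //; split=> //; apply: (mulfI u10).
  by rewrite w0 mulrA [u1 * _]mulrC divfK.
have u20 : u2 = 0.
  by apply/eqP; move/eqP: du; rewrite u10 expr0n eq_sym expf_eq0.
have [v10|v10] := eqVneq v1 0; last first.
  exists (v2 / v1); first by rewrite exprMn exprVn -dv divff // expf_neq0.
  by rewrite divfK // u10 u20 mulr0.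
have v20 : v2 = 0.
  by apply/eqP; move/eqP: dv; rewrite v10 expr0n eq_sym expf_eq0.
by exists 1; rewrite ?expr1n // u10 u20 v10 v20 mulr0.
Qed.

(* S_3 acts on the sum of the sign representation (the coordinate e) and
   two copies of its 2-dimensional irreducible representation. *)
Lemma S3_separation (e u1 u2 v1 v2 e' u1' u2' v1' v2' : k) :
    (2%:R != 0 :> k) ->
    e' ^+ 2 = e ^+ 2 ->
    u1' * u2' = u1 * u2 -> u1' * v2' + u2' * v1' = u1 * v2 + u2 * v1 ->
    v1' * v2' = v1 * v2 ->
    u1' ^+ 3 + u2' ^+ 3 = u1 ^+ 3 + u2 ^+ 3 ->
    u1' ^+ 2 * v1' + u2' ^+ 2 * v2' = u1 ^+ 2 * v1 + u2 ^+ 2 * v2 ->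
    u1' * v1' ^+ 2 + u2' * v2' ^+ 2 = u1 * v1 ^+ 2 + u2 * v2 ^+ 2 ->
    v1' ^+ 3 + v2' ^+ 3 = v1 ^+ 3 + v2 ^+ 3 ->
    e' * (u1' * v2' - u2' * v1') = e * (u1 * v2 - u2 * v1) ->
    e' * (u1' ^+ 3 - u2' ^+ 3) = e * (u1 ^+ 3 - u2 ^+ 3) ->
    e' * (v1' ^+ 3 - v2' ^+ 3) = e * (v1 ^+ 3 - v2 ^+ 3) ->
  exists2 z, z ^+ 3 = 1 &
    (e' = e /\ rotated z u1 u2 v1 v2 u1' u2' v1' v2') \/
    (e' = - e /\ rotated z u2 u1 v2 v1 u1' u2' v1' v2').
Proof.
move=> two0 He Huu Huv Hvv Hc30 Hc21 Hc12 Hc03 Hw Hd30 Hd03.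
have neg0 x : e != 0 -> - e * x = e * x -> x = 0.
  move=> e0 /eqP; rewrite mulNr eq_sym -subr_eq0 opprK -mulr2n -mulr_natl.
  by rewrite !mulf_eq0 (negPf two0) (negPf e0) => /eqP.
have [z z3 [] rot] := std2_separation Huu Huv Hvv Hc30 Hc21 Hc12 Hc03.
  move/eqP: He; rewrite eqf_sqr => /orP[/eqP e'E|/eqP e'E].
    by exists z => //; left.
  have [e0|e0] := eqVneq e 0.
    by exists z => //; left; rewrite e'E e0 oppr0.
  case: rot => ? ? ? ?; subst.
  (* Here e changes sign while (u, v) is rotated. Rotations preserve the three functions multiplied
     by e, so each equals its own negative. The reflection then found fixes (u, v), and composing it
     with the rotation gives a group element that also negates e. *)
  have w0 : u1 * v2 - u2 * v1 = 0.
    by apply: neg0 => //; rewrite -Hw cube_root_mul // cube_root_mul'.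
  have du0 : u1 ^+ 3 - u2 ^+ 3 = 0.
    by apply: neg0 => //; rewrite -Hd30 !exprMn z3 !mul1r.
  have dv0 : v1 ^+ 3 - v2 ^+ 3 = 0.
    by apply: neg0 => //; rewrite -Hd03 !exprMn z3 !mul1r.
  have [t t3 [-> ->]] := std2_reflection w0 du0 dv0.
  have tt x : t ^+ 2 * (t * x) = x by rewrite mulrA -exprSr t3 mul1r.
  have zt2 : (z * t ^+ 2) ^+ 2 = z ^+ 2 * t.
    have -> : (z * t ^+ 2) ^+ 2 = z ^+ 2 * t * t ^+ 3 by ring.
    by rewrite t3 mulr1.
  exists (z * t ^+ 2).
    by rewrite exprMn z3 mul1r -exprM mulnC exprM t3 expr1n.
  right; split=> //; rewrite /rotated zt2.
  by split; first [by rewrite mulrA | by rewrite -[RHS]mulrA tt].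
move/eqP: He; rewrite eqf_sqr => /orP[/eqP e'E|/eqP e'E]; last first.
  by exists z => //; right.
have [e0|e0] := eqVneq e 0.
  by exists z => //; right; rewrite e'E e0 oppr0.
case: rot => ? ? ? ?; subst.
(* The opposite mismatch: e is kept while (u, v) is reflected, which negates the three functions.
   They vanish again, and the reflection, composed with one fixing (u, v), becomes the rotation by z
   t. *)
have w0 : u1 * v2 - u2 * v1 = 0.
  by apply: neg0 => //; rewrite -Hw cube_root_mul // cube_root_mul' //; ring.
have du0 : u1 ^+ 3 - u2 ^+ 3 = 0.
  by apply: neg0 => //; rewrite -Hd30 !exprMn z3; ring.
have dv0 : v1 ^+ 3 - v2 ^+ 3 = 0.
  by apply: neg0 => //; rewrite -Hd03 !exprMn z3; ring.
have [t t3 [-> ->]] := std2_reflection w0 du0 dv0.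
have tt x : t ^+ 2 * (t * x) = x by rewrite mulrA -exprSr t3 mul1r.
exists (z * t); first by rewrite exprMn z3 t3 mul1r.
left; split=> //; rewrite /rotated exprMn.
by split; first [by rewrite mulrA | by rewrite -[RHS]mulrA tt].
Qed.

End Separation.

(** * Normal form of the cubic component *)

Section NormalForm.
Variable k : fieldType.
Implicit Types (p : {mpoly k[2]}) (g : 'M[k]_2) (s : seq k).

Definition mx2 (a b c d : k) : 'M[k]_2 :=
  \matrix_(i, j) (if i == 0 then if j == 0 then a else b
                  else if j == 0 then c else d).

Lemma det_mx2 a b c d : \det (mx2 a b c d) = a * d - b * c.
Proof. by rewrite det2E !mxE. Qed.

Lemma lsub_form n s g : lsub g (form n s) =
  \sum_(i < n.+1) s`_i *:
    ((g 0 0 *: 'X_0 + g 0 1 *: 'X_1) ^+ (n - i) *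
     (g 1 0 *: 'X_0 + g 1 1 *: 'X_1) ^+ i).
Proof.
rewrite /form /lsub raddf_sum; apply: eq_bigr => i _.
by rewrite /= -/(lsub g _) lsubZ lsubM !lsubXn !lsubX.
Qed.

Fact lin_first (V : lmodType k) c (x y : V) : c *: x + 0 *: y = c *: x.
Proof. by rewrite scale0r addr0. Qed.

Fact lin_second (V : lmodType k) c (x y : V) : 0 *: x + c *: y = c *: y.
Proof. by rewrite scale0r add0r. Qed.

Lemma lsub_diag_form n s z :
  lsub (mx2 1 0 0 z) (form n s) = form n (mkseq (fun i => z ^+ i * s`_i) n.+1).
Proof.
rewrite lsub_form; apply: eq_bigr => i _.
rewrite !mxE /= lin_first lin_second scale1r (nth_mkseq _ _ (ltn_ord i)).
by rewrite exprZn -scalerAr scalerA mulrC.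
Qed.

Lemma lsub_antidiag_form n s z :
  lsub (mx2 0 z 1 0) (form n s) =
  form n (mkseq (fun i => z ^+ i * s`_(n - i)) n.+1).
Proof.
rewrite lsub_form (reindex_inj rev_ord_inj); apply: eq_bigr => i _.
rewrite !mxE /= lin_first lin_second scale1r (nth_mkseq _ _ (ltn_ord i)).
have le_in : (i <= n)%N by rewrite -ltnS.
rewrite exprZn -scalerAl subSS subKn // scalerA.
by rewrite ['X_1 ^+ _ * _]mulrC [s`_(n - i) * _]mulrC.
Qed.

Lemma form_homog n s : form n s \is n.-homog.
Proof.
apply: rpred_sum => i _; apply: rpredZ; rewrite monomialE dhomogX /=.
by rewrite mdegD !mdegMn !mdeg1 !mul1n subnK // -ltnS.
Qed.

Lemma ord2 (i : 'I_2) : i = 0 \/ i = 1.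
Proof. by case: i => [[|[|i]] lti] //; [left|right]; apply/val_inj. Qed.

Lemma expos_eta (m : 'X_{1..2}) : m = expos (m 0) (m 1).
Proof. by apply/mnmP => i; case: (ord2 i) => ->; rewrite ?expos0 ?expos1. Qed.

Lemma homog_form n p : p \is n.-homog -> p = form n (mkseq (bcoef n p) n.+1).
Proof.
move=> hp; apply/mpolyP => m; have [degm|degm] := eqVneq (mdeg m) n; last first.
  by rewrite !(dhomog_nemf_coeff _ degm) // form_homog.
have m01 : (m 0%R + m 1%R)%N = n.
  by rewrite -degm mdegE !big_ord_recl big_ord0 addn0 lift01.
have le_m1n : (m 1%R <= n)%N by rewrite -m01 leq_addl.
have -> : m = expos (n - m 1%R) (m 1%R) by rewrite -m01 addnK -expos_eta.
by rewrite mcoeff_form // nth_mkseq.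
Qed.

Lemma lsub_homog n p g : p \is n.-homog -> lsub g p \is n.-homog.
Proof.
move=> /homog_form ->; rewrite lsub_form.
apply: rpred_sum => i _; apply: rpredZ.
have le_in : (i <= n)%N by rewrite -ltnS.
have lin a b : (a *: 'X_0 + b *: 'X_1 : {mpoly k[2]}) \is 1.-homog.
  by apply: rpredD; apply: rpredZ; rewrite dhomogX /= mdeg1.
rewrite -[X in _ \is X.-homog](subnK le_in); apply: dhomogM.
  by rewrite -[X in _ \is X.-homog]mul1n dhomogMn.
by rewrite -[X in _ \is X.-homog]mul1n dhomogMn.
Qed.

Lemma meval_lsub g p (v : 'I_2 -> k) :
  (lsub g p).@[v] = p.@[fun i => g i 0 * v 0 + g i 1 * v 1].
Proof.
rewrite /lsub comp_mpoly_meval; apply: meval_eq => i.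
rewrite tnth_mktuple raddf_sum !big_ord_recl big_ord0 addr0 /=.
by rewrite lift01 !mevalZ !mevalXU.
Qed.

Lemma meval_form n s (v : 'I_2 -> k) :
  (form n s).@[v] = \sum_(i < n.+1) s`_i * (v 0 ^+ (n - i) * v 1 ^+ i).
Proof.
rewrite /form raddf_sum; apply: eq_bigr => i _ /=.
by rewrite mevalZ mevalM !rmorphXn /= !mevalXU.
Qed.

Lemma meval_homogZ n p c (v w : 'I_2 -> k) : p \is n.-homog ->
  (forall i, w i = c * v i) -> p.@[w] = c ^+ n * p.@[v].
Proof.
move=> /homog_form -> wE; rewrite !meval_form mulr_sumr; apply: eq_bigr => i _.
have le_in : (i <= n)%N by rewrite -ltnS.
rewrite !wE !exprMn mulrACA -exprD subnK //.
by rewrite [LHS]mulrCA.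
Qed.

Lemma CG_quintic_homog (f : 'I_2 -> {mpoly k[2]}) :
  (forall i, f i \is 4.-homog) -> CG_quintic f \is 5.-homog.
Proof.
move=> hf; have hX i : ('X_i : {mpoly k[2]}) \is 1.-homog.
  by rewrite dhomogX /= mdeg1.
apply: rpredB; first exact: (dhomogM (hX 1) (hf 0)).
exact: (dhomogM (hX 0) (hf 1)).
Qed.

Lemma CG_cubic_homog (f : 'I_2 -> {mpoly k[2]}) :
  (forall i, f i \is 4.-homog) -> CG_cubic f \is 3.-homog.
Proof.
move=> hf; rewrite /CG_cubic; apply: rpredD.
  by rewrite (homog_form (hf 0)) mderiv0_form // form_homog.
by rewrite (homog_form (hf 1)) mderiv1_form // form_homog.
Qed.

Lemma lsub_eq0 p g : \det g != 0 -> lsub g p = 0 -> p = 0.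
Proof.
move=> d0 p0; have gu : g \in unitmx by rewrite unitmxE unitfE.
by rewrite -[p]lsub1 -(mulmxV gu) lsub_mulmx p0 /lsub comp_mpoly0.
Qed.

(** 2 w + 1 = w - w^2 is a square root of -3, hence nonzero in characteristic zero. *)
Lemma cube_root_facts (w : k) : [pchar k] =i pred0 -> 1 + w + w ^+ 2 = 0 ->
  [/\ w ^+ 2 = - 1 - w, w ^+ 3 = 1 & 2%:R * w + 1 != 0].
Proof.
move=> char0 w0; have w2 : w ^+ 2 = - 1 - w.
  by apply/eqP; rewrite -subr_eq0 -w0; apply/eqP; ring.
split=> //; first by rewrite exprS w2 mulrBr -expr2 w2; ring.
have : (2%:R * w + 1) ^+ 2 = - 3%:R.
  have -> : (2%:R * w + 1) ^+ 2 = 4%:R * w ^+ 2 + 4%:R * w + 1 by ring.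
  by rewrite w2; ring.
apply: contra_eq_neq => ->.
by rewrite expr0n eq_sym oppr_eq0 ((pcharf0P k).1 char0).
Qed.

(* The coefficient vector of p is orthogonal to (1, -z, z^2, -1) for the three
   cube roots of unity z. *)
Lemma cubic_cube_roots (w : k) p : [pchar k] =i pred0 ->
    1 + w + w ^+ 2 = 0 -> p \is 3.-homog ->
    (forall z, z \in [:: 1; w; w ^+ 2] -> forall v : 'I_2 -> k,
       v 0 = 1 -> v 1 = - z -> p.@[v] = 0) ->
  exists c, p = c *: form 3 [:: 1; 0; 0; 1].
Proof.
move=> char0 w0 hp pz; rewrite (homog_form hp) /mkseq /=.
have {pz} : forall z, z \in [:: 1; w; w ^+ 2] ->
    bcoef 3 p 0 - bcoef 3 p 1 * z + bcoef 3 p 2 * z ^+ 2 -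
      bcoef 3 p 3 * z ^+ 3 = 0.
  move=> z /pz /(_ (fun i => if i == 0 then 1 else - z) erefl erefl).
  rewrite {1}(homog_form hp) meval_form !big_ord_recl big_ord0 /= => <-.
  by move: (bcoef 3 p 0) (bcoef 3 p 1) (bcoef 3 p 2) (bcoef 3 p 3) => *; ring.
move: (bcoef 3 p 0) (bcoef 3 p 1) (bcoef 3 p 2) (bcoef 3 p 3) => a b c d E.
have [w2 w3 dw0] := cube_root_facts char0 w0.
have w4 : (w ^+ 2) ^+ 2 = w by rewrite -exprM exprS w3 mulr1.
have w6 : (w ^+ 2) ^+ 3 = 1 by rewrite -exprM mulnC exprM w3 expr1n.
have E1 : a - b + c - d = 0.
  by rewrite -[RHS](E 1 (mem_head _ _)); ring.
have Ew : a - b * w + c * (- 1 - w) - d = 0.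
  by rewrite -[RHS](E w) ?inE ?eqxx ?orbT // w2 w3 mulr1.
have Ew2 : a - b * (- 1 - w) + c * w - d = 0.
  by rewrite -[RHS](E (w ^+ 2)) ?inE ?eqxx ?orbT // w4 w6 w2 mulr1.
have three0 : 3%:R != 0 :> k by rewrite ((pcharf0P k).1 char0).
(* Adding the three relations eliminates b and c, because the cube roots of unity sum to zero. *)
have da : d = a.
  apply/esym/eqP; rewrite -subr_eq0; apply/eqP/(mulfI three0).
  rewrite mulr0.
  have -> : 3%:R * (a - d) = (a - b + c - d) + (a - b * w + c * (- 1 - w) - d) +
      (a - b * (- 1 - w) + c * w - d) by ring.
  by rewrite E1 Ew Ew2 !addr0.
have cb : c = b.
  by apply/eqP; rewrite -subr_eq0; apply/eqP; rewrite -E1 da; ring.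
have c0 : c = 0.
  apply: (mulIf dw0); rewrite mul0r.
  have -> : c * (2%:R * w + 1) = - (a - b * w + c * (- 1 - w) - d).
    by rewrite da -cb; ring.
  by rewrite Ew oppr0.
exists a; rewrite -form_scales; apply: eq_form.
by do 4? [case=> [_|]] => //=; rewrite ?mulr0 ?mulr1 // -?cb.
Qed.

Lemma wedge_neq0 (u v : 'rV[k]_2) : v != 0 -> (forall c, u != c *: v) ->
  u 0 0 * v 0 1 - v 0 0 * u 0 1 != 0.
Proof.
move=> v0 uv; apply/eqP => /subr0_eq e.
have ext (a b : 'rV[k]_2) : a 0 0 = b 0 0 -> a 0 1 = b 0 1 -> a = b.
  by move=> e0 e1; apply/rowP => i; case: (ord2 i) => ->.
have [vx0|vx0] := eqVneq (v 0 0) 0.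
  have vy0 : v 0 1 != 0.
    by apply: contra_neq v0 => vy0; apply: ext; rewrite !mxE.
  case/eqP: (uv (u 0 1 / v 0 1)); apply: ext; rewrite !mxE;
    last by rewrite divfK.
  by apply: (mulIf vy0); rewrite e vx0 mulr0 !mul0r.
case/eqP: (uv (u 0 0 / v 0 0)); apply: ext; rewrite !mxE;
  first by rewrite divfK.
by apply: (mulfI vx0); rewrite -e mulrA [v 0 0 * _]mulrC divfK.
Qed.

(* If p vanishes at P0, P1 and P2, where d01 P2 = d21 P0 + d02 P1, then g sends
   (1, -1), (1, -w) and (1, -w^2) to multiples of P0, P1 and P2. *)
Lemma cubic_normal_form (w : k) p : [pchar k] =i pred0 ->
    1 + w + w ^+ 2 = 0 -> p \is 3.-homog -> has_distinct_roots 3 p ->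
  exists g c, [/\ \det g != 0, c != 0 & lsub g p = c *: form 3 [:: 1; 0; 0; 1]].
Proof.
move=> char0 w0 hp [p0 [P [Proot Pdist]]].
have [w2 w3 dw0] := cube_root_facts char0 w0.
have wedge i j : i != j -> P i 0 0 * P j 0 1 - P j 0 0 * P i 0 1 != 0.
  by move=> ij; apply: wedge_neq0; [case: (Proot j) | exact: Pdist].
pose i0 : 'I_3 := Ordinal (isT : 0 < 3)%N.
pose i1 : 'I_3 := Ordinal (isT : 1 < 3)%N.
pose i2 : 'I_3 := Ordinal (isT : 2 < 3)%N.
have := (wedge i0 i1 isT, wedge i2 i1 isT, wedge i0 i2 isT).
case: (Proot i0) (Proot i1) (Proot i2) => [_ r0] [_ r1] [_ r2].
move: (P i0) (P i1) (P i2) r0 r1 r2 {wedge Proot Pdist} => P0 P1 P2 r0 r1 r2.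
set d01 := _ - _; set d21 := _ - _; set d02 := _ - _ => -[[d01N0 d21N0] d02N0].
pose g := mx2
  (d02 * P1 0 0 - w ^+ 2 * d21 * P0 0 0) (d02 * P1 0 0 - w * d21 * P0 0 0)
  (d02 * P1 0 1 - w ^+ 2 * d21 * P0 0 1) (d02 * P1 0 1 - w * d21 * P0 0 1).
have gN0 : \det g != 0.
  rewrite det_mx2.
  have -> : (d02 * P1 0 0 - w ^+ 2 * d21 * P0 0 0) *
      (d02 * P1 0 1 - w * d21 * P0 0 1) -
    (d02 * P1 0 0 - w * d21 * P0 0 0) *
      (d02 * P1 0 1 - w ^+ 2 * d21 * P0 0 1) = d02 * d21 * d01 * (2%:R * w + 1).
    by rewrite w2 /d01; ring.
  by rewrite !mulf_neq0.
have [] := @cubic_cube_roots w (lsub g p) char0 w0 (lsub_homog _ hp).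
  move=> z; rewrite !inE => zE v v0 v1; rewrite meval_lsub v0 v1.
  have root_scale c (u r : 'I_2 -> k) :
      p.@[r] = 0 -> (forall j, u j = c * r j) -> p.@[u] = 0.
    by move=> pr uE; rewrite (meval_homogZ hp uE) pr mulr0.
  case/or3P: zE => /eqP ->.
  - apply: (root_scale ((2%:R * w + 1) * d21) _ (P0 0) r0) => j.
    case: (ord2 j) => ->; rewrite !mxE /= w2; ring.
  - apply: (root_scale ((1 - w) * d02) _ (P1 0) r1) => j.
    by case: (ord2 j) => ->; rewrite !mxE /=; ring.
  - apply: (root_scale ((1 - w ^+ 2) * d01) _ (P2 0) r2) => j.
    have -> : g j 0 * 1 + g j 1 * - w ^+ 2 =
        (1 - w ^+ 2) * (d02 * P1 0 j + d21 * P0 0 j) +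
        (w ^+ 3 - 1) * d21 * P0 0 j.
      by case: (ord2 j) => ->; rewrite !mxE /=; ring.
    rewrite w3 subrr !mul0r addr0 -mulrA; congr (_ * _).
    by case: (ord2 j) => ->; rewrite /d01 /d02 /d21; ring.
move=> c gp; exists g, c; split=> //.
apply: contra_neq p0 => c0; apply: (lsub_eq0 gN0).
by rewrite gp c0 scale0r.
Qed.

End NormalForm.

(** * The normal form is determined by the fourteen functions *)

Section Separation.
Variables (k : fieldType) (char0 : [pchar k] =i pred0).

Lemma divr_inj (c x y : k) : c != 0 -> x / c = y / c -> x = y.
Proof. by move=> c0 /(mulIf (invr_neq0 c0)). Qed.

Lemma eq_of_multiple (c x y a b : k) :
  c * x = a -> c * y = b -> c != 0 -> a = b -> x = y.
Proof. by move=> <- <- c0 /(mulfI c0). Qed.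

Lemma numerators_eq (F F' G : {mpoly k[2]}) : inv_D G != 0 ->
  fourteen_functions F G = fourteen_functions F' G ->
  [/\ P1 F G = P1 F' G, P2 F G = P2 F' G, P3 F G = P3 F' G
    & P4 F G = P4 F' G] /\
  [/\ P5 F G = P5 F' G, P6 F G = P6 F' G, Q_e2 F G = Q_e2 F' G,
      Q_p02 F G = Q_p02 F' G & Q_p12 F G = Q_p12 F' G] /\
  [/\ Q_p03 F G = Q_p03 F' G, Q_w2 F G = Q_w2 F' G, Q_w21 F G = Q_w21 F' G,
      Q_w12 F G = Q_w12 F' G & Q_w03 F G = Q_w03 F' G].
Proof.
move=> D0 eqFF'; have DX n : inv_D G ^+ n != 0 by rewrite expf_neq0.
have nat0 n : n.+1%:R != 0 :> k by apply: natS_neq0.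
have c2 : 54%:R != 0 :> k by [].
(* Large denominators are factored into small numerals, each seen to be nonzero as a successor. *)
have c3 : 20432412%:R != 0 :> k.
  have -> : 20432412%:R = 27%:R * 27%:R * 28%:R * 1001%:R :> k by ring.
  by rewrite !(mulf_neq0, nat0).
have c5 : 2270268%:R != 0 :> k.
  have -> : 2270268%:R = 81%:R * 28%:R * 1001%:R :> k by ring.
  by rewrite !(mulf_neq0, nat0).
have c6 : 27027%:R != 0 :> k.
  have -> : 27027%:R = 27%:R * 1001%:R :> k by ring.
  by rewrite !(mulf_neq0, nat0).
have value i := congr1 (fun l => nth 0 l i) eqFF'.
split; [split|split; split].
- by apply: (divr_inj (mulf_neq0 (nat0 2) D0)); exact: (value 0%N).
- by apply: (divr_inj (mulf_neq0 c2 (DX 3))); exact: (value 1%N).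
(* The third function is 3 U3, so the factor 3, the successor of 2, is cancelled as well. *)
- apply: (divr_inj (mulf_neq0 c3 (DX 4))); apply: (mulfI (nat0 2)).
  exact: (value 2).
- by apply: (divr_inj (mulf_neq0 (nat0 17) (DX 3))); exact: (value 3).
- by apply: (divr_inj (mulf_neq0 c5 (DX 4))); exact: (value 4).
- by apply: (divr_inj (mulf_neq0 c6 (DX 6))); exact: (value 5).
- by apply: (divr_inj (DX 3)); exact: (value 6).
- by apply: (divr_inj (DX 3)); exact: (value 7).
- by apply: (divr_inj (DX 4)); exact: (value 8).
- by apply: (divr_inj (DX 4)); exact: (value 9).
- by apply: (divr_inj (DX 4)); exact: (value 10).
- by apply: (divr_inj (DX 6)); exact: (value 11).
- by apply: (divr_inj (DX 6)); exact: (value 12).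
- by apply: (divr_inj (DX 6)); exact: (value 13).
Qed.

Lemma homog_quintic (F : {mpoly k[2]}) : F \is 5.-homog ->
  exists e s u1 u2 v1 v2, F = quintic e s u1 u2 v1 v2.
Proof.
move=> /homog_form ->; rewrite /mkseq /=.
move: (bcoef 5 F 0) (bcoef 5 F 1) (bcoef 5 F 2) (bcoef 5 F 3) (bcoef 5 F 4)
  (bcoef 5 F 5) => a0 a1 a2 a3 a4 a5.
exists ((a1 + a4) / 10%:R), ((a1 - a4) / 10%:R), a5, (- a0), (a2 / 10%:R),
  (- (a3 / 10%:R)).
have ten0 : 10%:R != 0 :> k by apply: natS_neq0.
by congr form; congr [:: _; _; _; _; _; _]; field.
Qed.

Local Notation G := (form 3 [:: 1; 0; 0; 1] : {mpoly k[2]}).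

Lemma quintic_rotation e s u1 u2 v1 v2 u1' u2' v1' v2' z : z ^+ 3 = 1 ->
  rotated z u1 u2 v1 v2 u1' u2' v1' v2' ->
  CG_equiv (quintic e s u1 u2 v1 v2) G (quintic e s u1' u2' v1' v2') G.
Proof.
move=> z3 [-> -> -> ->].
have z0 : z != 0.
  by apply: contra_eq_neq z3 => ->; rewrite expr0n eq_sym oner_neq0.
(* The determinant is z, so the scalar z^2 makes the factor of the cubic z^3 = 1. The coefficient of
   x^(5-i) y^i in the quintic is multiplied by z^(i+2). *)
exists (mx2 1 0 0 z), (z ^+ 2).
rewrite det_mx2 mul1r mul0r subr0 -exprSr z3 !lsub_diag_form -!form_scales.
split; [by [] | exact: expf_neq0 | |]; apply: eq_form.
  case=> [|[|[|[|[|[|//]]]]]] _; rewrite /=; ring: z3.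
case=> [|[|[|[|//]]]] _; rewrite /=; ring: z3.
Qed.

Lemma quintic_reflection e s u1 u2 v1 v2 u1' u2' v1' v2' z : z ^+ 3 = 1 ->
  rotated z u2 u1 v2 v1 u1' u2' v1' v2' ->
  CG_equiv (quintic e s u1 u2 v1 v2) G (quintic (- e) s u1' u2' v1' v2') G.
Proof.
move=> z3 [-> -> -> ->].
have z0 : z != 0.
  by apply: contra_eq_neq z3 => ->; rewrite expr0n eq_sym oner_neq0.
(* The determinant is -z, so fixing the cubic forces a minus sign on the quintic. It negates e, and
   it is why [quintic] carries the signs - u2 and - v2. *)
exists (mx2 0 z 1 0), (- z ^+ 2).
rewrite det_mx2 mul0r mulr1 sub0r mulrNN -exprSr z3.
rewrite !lsub_antidiag_form -!form_scales oppr_eq0.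
split; [by [] | by rewrite oppr_eq0 expf_neq0 | |]; apply: eq_form.
  case=> [|[|[|[|[|[|//]]]]]] _; rewrite /=; ring: z3.
case=> [|[|[|[|//]]]] _; rewrite /=; ring: z3.
Qed.

Lemma normal_values_inj e s u1 u2 v1 v2 e' s' u1' u2' v1' v2' :
  fourteen_functions (quintic e s u1 u2 v1 v2) G =
    fourteen_functions (quintic e' s' u1' u2' v1' v2') G ->
  CG_equiv (quintic e s u1 u2 v1 v2) G (quintic e' s' u1' u2' v1' v2') G.
Proof.
have D0 : inv_D G != 0 by rewrite inv_DE // oppr_eq0 natS_neq0.
move=> /(numerators_eq D0).
case=> -[h1 h2 h3 h4] [[h5 h6 h7 h8 h9] [h10 h11 h12 h13 h14]].
have nat0 n : n.+1%:R != 0 :> k by apply: natS_neq0.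
have natX0 n m : n.+1%:R ^+ m != 0 :> k by rewrite expf_neq0.
pose nonzero := (mulf_neq0, nat0, natX0).
have Hs : s' = s.
  apply: (eq_of_multiple (s_values char0 e' s' u1' u2' v1' v2')
    (s_values char0 e s u1 u2 v1 v2)); first by rewrite !nonzero.
  rewrite h1; exact: erefl.
have He2 : e' ^+ 2 = e ^+ 2.
  apply: (eq_of_multiple (e2_values char0 e' s' u1' u2' v1' v2')
    (e2_values char0 e s u1 u2 v1 v2)); first by rewrite !nonzero.
  rewrite h7; exact: erefl.
have Huu : u1' * u2' = u1 * u2.
  apply: (eq_of_multiple (uu_values char0 e' s' u1' u2' v1' v2')
    (uu_values char0 e s u1 u2 v1 v2)); first by rewrite !nonzero.
  rewrite h2 h4 h8; exact: erefl.
have Huv : u1' * v2' + u2' * v1' = u1 * v2 + u2 * v1.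
  apply: (eq_of_multiple (uv_values char0 e' s' u1' u2' v1' v2')
    (uv_values char0 e s u1 u2 v1 v2)); first by rewrite !nonzero.
  rewrite h2 h4 h8; exact: erefl.
have Hvv : v1' * v2' = v1 * v2.
  apply: (eq_of_multiple (vv_values char0 e' s' u1' u2' v1' v2')
    (vv_values char0 e s u1 u2 v1 v2)); first by rewrite !nonzero.
  rewrite h2 h4 h8; exact: erefl.
have Hc30 : u1' ^+ 3 + u2' ^+ 3 = u1 ^+ 3 + u2 ^+ 3.
  apply: (eq_of_multiple (c30_values char0 e' s' u1' u2' v1' v2')
    (c30_values char0 e s u1 u2 v1 v2)); first by rewrite !nonzero.
  rewrite h3 h5 h9 h10; exact: erefl.
have Hc21 : u1' ^+ 2 * v1' + u2' ^+ 2 * v2' = u1 ^+ 2 * v1 + u2 ^+ 2 * v2.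
  apply: (eq_of_multiple (c21_values char0 e' s' u1' u2' v1' v2')
    (c21_values char0 e s u1 u2 v1 v2)); first by rewrite !nonzero.
  rewrite h3 h5 h9 h10; exact: erefl.
have Hc12 : u1' * v1' ^+ 2 + u2' * v2' ^+ 2 = u1 * v1 ^+ 2 + u2 * v2 ^+ 2.
  apply: (eq_of_multiple (c12_values char0 e' s' u1' u2' v1' v2')
    (c12_values char0 e s u1 u2 v1 v2)); first by rewrite !nonzero.
  rewrite h3 h5 h9 h10; exact: erefl.
have Hc03 : v1' ^+ 3 + v2' ^+ 3 = v1 ^+ 3 + v2 ^+ 3.
  apply: (eq_of_multiple (c03_values char0 e' s' u1' u2' v1' v2')
    (c03_values char0 e s u1 u2 v1 v2)); first by rewrite !nonzero.
  rewrite h3 h5 h9 h10; exact: erefl.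
have Hew : e' * (u1' * v2' - u2' * v1') = e * (u1 * v2 - u2 * v1).
  apply: (eq_of_multiple (ew_values char0 e' s' u1' u2' v1' v2')
    (ew_values char0 e s u1 u2 v1 v2)); first by rewrite !nonzero.
  rewrite h11; exact: erefl.
have Hed30 : e' * (u1' ^+ 3 - u2' ^+ 3) = e * (u1 ^+ 3 - u2 ^+ 3).
  apply: (eq_of_multiple (ed30_values char0 e' s' u1' u2' v1' v2')
    (ed30_values char0 e s u1 u2 v1 v2)); first by rewrite !nonzero.
  rewrite h6 h12 h13 h14; exact: erefl.
have Hed03 : e' * (v1' ^+ 3 - v2' ^+ 3) = e * (v1 ^+ 3 - v2 ^+ 3).
  apply: (eq_of_multiple (ed03_values char0 e' s' u1' u2' v1' v2')
    (ed03_values char0 e s u1 u2 v1 v2)); first by rewrite !nonzero.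
  rewrite h6 h12 h13 h14; exact: erefl.
have two0 : 2%:R != 0 :> k by apply: nat0.
have [z z3] := S3_separation two0 He2 Huu Huv Hvv Hc30 Hc21 Hc12 Hc03 Hew Hed30
  Hed03.
rewrite -Hs; case=> -[-> rot].
  exact: (quintic_rotation _ _ z3 rot).
exact: (quintic_reflection _ _ z3 rot).
Qed.

End Separation.

Lemma cube_root_of_unity (k : closedFieldType) :
  exists w : k, 1 + w + w ^+ 2 = 0.
Proof.
have [w wE] := @solve_monicpoly k 2 (fun=> - 1) isT.
by exists w; rewrite wE !big_ord_recl big_ord0 /=; ring.
Qed.

Lemma CG_normal_form (k : closedFieldType) (phi : ratmap k 4) :
    [pchar k] =i pred0 -> has_distinct_roots 3 (CG_cubic phi) ->
  exists e s u1 u2 v1 v2, CG_equiv (CG_quintic phi) (CG_cubic phi)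
    (quintic e s u1 u2 v1 v2) (form 3 [:: 1; 0; 0; 1]).
Proof.
move=> char0 phi_roots; have [w w0] := cube_root_of_unity k.
have hG := CG_cubic_homog (@ratmap_homog _ _ phi).
have hF := CG_quintic_homog (@ratmap_homog _ _ phi).
have [g [c [g0 c0 gG]]] := cubic_normal_form char0 w0 hG phi_roots.
(* The free scalar turns the leading coefficient of the cubic into 1, so no cube root of c is
   extracted. *)
pose a := (c * \det g)^-1; have a0 : a != 0 by rewrite invr_eq0 mulf_neq0.
have hF' : a *: lsub g (CG_quintic phi) \is 5.-homog.
  by apply: rpredZ; apply: lsub_homog.
have [e [s [u1 [u2 [v1 [v2 FE]]]]]] := homog_quintic char0 hF'.
exists e, s, u1, u2, v1, v2, g, a.
split; [exact: g0 | exact: a0 | exact: esym FE |].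
by rewrite gG scalerA /a invfM divfK // mulVf // scale1r.
Qed.

Theorem corollary6p7 (k : closedFieldType) (char0 : [pchar k] =i pred0)
    (phi psi : ratmap k 4)
    (phi_roots : has_distinct_roots 3 (CG_cubic phi))
    (psi_roots : has_distinct_roots 3 (CG_cubic psi)) :
  conjugate phi psi <-> fourteen_values phi = fourteen_values psi.
Proof.
rewrite /fourteen_values; split=> [|eq_values].
  by move/(conjugate_CG_equiv _ _ char0)/fourteen_functions_equiv => ->.
apply/(conjugate_CG_equiv _ _ char0).
have [e [s [u1 [u2 [v1 [v2 phiN]]]]]] := CG_normal_form char0 phi_roots.
have [e' [s' [u1' [u2' [v1' [v2' psiN]]]]]] := CG_normal_form char0 psi_roots.
apply: (CG_equiv_trans phiN); apply: (CG_equiv_trans _ (CG_equiv_sym psiN)).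
apply: (normal_values_inj char0).
rewrite (fourteen_functions_equiv phiN) (fourteen_functions_equiv psiN).
exact: eq_values.
Qed.
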